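(* Let $G$ be a graph. Then the following are equivalent: (a) $\Omega_E(G)$ is $\sigma$-compact. (b) $\Omega_E(G)$ is Menger. (c) $\Omega_E(G)$ is Lindelöf and does not contain a closed topological copy of the Baire space $\omega^\omega$. Moreover, $\Omega_E(G)$ is a $D$-space (for every graph $G$).
   Context: A graph is a pair $G=(V(G),E(G))$ with $V(G)$ an arbitrary set and $E(G)\subseteq [V(G)]^2$ (two-element subsets). A ray in $G$ is an injective sequence of vertices $(v_0,v_1,\dots)$ with $\{v_i,v_{i+1}\}\in E(G)$ for all $i$; a tail of it is $(v_n,v_{n+1},\dots)$ for some $n$. For finite $F\subseteq E(G)$, $G\setminus F$ is the graph $(V(G),E(G)\setminus F)$; a connected component is a maximal connected subgraph. Two rays of $G$ are edge-equivalent if for every finite $F\subseteq E(G)$ they have tails lying in the same connected component of $G\setminus F$. An edge-end is an equivalence class of rays under edge-equivalence, and $\Omega_E(G)$ is the set of edge-ends. For an edge-end $\epsilon$ and finite $F\subseteq E(G)$, $G(\epsilon,F)$ is the unique connected component of $G\setminus F$ containing a tail of every ray of $\epsilon$, and $\Omega_E(\epsilon,F)$ is the set of all edge-ends having a ray contained in $G(\epsilon,F)$. A set $U\subseteq\Omega_E(G)$ is open if for every $\epsilon\in U$ there is a finite $F\subseteq E(G)$ with $\Omega_E(\epsilon,F)\subseteq U$; this topologizes $\Omega_E(G)$, the edge-end space of $G$. A space $X$ is Menger if for every sequence $(\mathcal U_n:n\in\omega)$ of open covers of $X$ there are finite $\mathcal F_n\subseteq\mathcal U_n$ with $X=\bigcup_{n\in\omega}\bigcup\mathcal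 F_n$. $X$ is Lindelöf if every open cover has a countable subcover, and $\sigma$-compact if it is a countable union of compact subspaces. A closed topological copy of $\omega^\omega$ (product topology of discrete $\omega$) is a closed subspace homeomorphic to it. $X$ is a $D$-space if for every family $(U_x:x\in X)$ of open sets with $x\in U_x$ there is a closed discrete set $D\subseteq X$ with $\bigcup_{x\in D}U_x=X$. *)

(* Defs.v *)
From HB Require Import structures.
From mathcomp Require Import all_boot all_order all_algebra.
From mathcomp Require Import all_classical all_reals topology.

Set Implicit Arguments.
Unset Strict Implicit.
Unset Printing Implicit Defensive.

Local Open Scope classical_set_scope.

(* A graph has its vertices in an ambient type [U], so that its subgraphs are
   graphs over the same [U]; a graph on a whole type has [vertices = setT]. *)
Record graph (U : Type) := Graph {
  vertices : set U;
  edges : set (set U);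
  edgesP : forall e, edges e ->
    exists x y, [/\ vertices x, vertices y, x <> y & e = [set x; y]] }.

Section Graphs.
Context {U : Type}.
Implicit Types (G H C : graph U) (F : set (set U)) (r s : nat -> U).

Definition subgraph H G :=
  vertices H `<=` vertices G /\ edges H `<=` edges G.

Lemma edges_delP G F e : (edges G `\` F) e ->
  exists x y, [/\ vertices G x, vertices G y, x <> y & e = [set x; y]].
Proof. by case=> /edgesP. Qed.

Definition del_edges G F : graph U := Graph (@edges_delP G F).

Definition walk G (x y : U) := exists n (p : nat -> U),
  [/\ p 0 = x, p n = y &
      forall i, (i < n)%N -> edges G [set p i; p i.+1]].

Definition connected_graph G :=
  vertices G !=set0 /\
  forall x y, vertices G x -> vertices G y -> walk G x y.

Definition component C G :=
  [/\ subgraph C G, connected_graph C &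
      forall C', subgraph C' G -> connected_graph C' -> subgraph C C' ->
        subgraph C' C].

Definition is_ray G r :=
  [/\ forall i, vertices G (r i), injective r &
      forall i, edges G [set r i; r i.+1]].

Definition tail n r : nat -> U := fun i => r (n + i)%N.

Definition edge_equiv G r s :=
  forall F, finite_set F -> F `<=` edges G ->
    exists C, [/\ component C (del_edges G F),
      exists n, is_ray C (tail n r) & exists m, is_ray C (tail m s)].

Definition is_edge_end G (e : set (nat -> U)) :=
  exists2 r, is_ray G r & e = [set s | is_ray G s /\ edge_equiv G r s].

Record edge_end G := EdgeEnd {
  end_rays : set (nat -> U);
  edge_endP : is_edge_end G end_rays }.

(* [end_component eps F C] says that C is G(eps, F). This C exists and is
   unique, see [end_component_ex] and [end_component_uniq]. *)
Definition end_component G (eps : edge_end G) F C :=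
  component C (del_edges G F) /\
  forall r, end_rays eps r -> exists n, is_ray C (tail n r).

Definition end_nbhd G (eps : edge_end G) F : set (edge_end G) :=
  [set eta | exists2 C, end_component eps F C & exists2 r, end_rays eta r & is_ray C r].

Definition end_open G (A : set (edge_end G)) :=
  forall eps, A eps -> exists F,
    [/\ finite_set F, F `<=` edges G & end_nbhd eps F `<=` A].

Lemma subgraph_trans G H C : subgraph C H -> subgraph H G -> subgraph C G.
Proof.
by move=> [a b] [c d]; split; [exact: subset_trans c|exact: subset_trans d].
Qed.

Lemma subgraph_anti G H : subgraph G H -> subgraph H G -> G = H.
Proof.
case: G H => [V E P] [W D Q] [/= a b] [/= c d].
have eV : V = W by apply/seteqP.
have eE : E = D by apply/seteqP.
by subst W D; congr Graph; exact: Prop_irrelevance.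
Qed.

Lemma is_ray_sub G H r : subgraph H G -> is_ray H r -> is_ray G r.
Proof. by move=> [a b] [c d e]; split => // i; [exact/a|exact/b]. Qed.

Lemma is_ray_tail G r n : is_ray G r -> is_ray G (tail n r).
Proof.
move=> [a b c]; split => [i|i j /b /addnI //|i]; first exact: a.
by rewrite /tail addnS; exact: c.
Qed.

Lemma walk_sub G H x y : subgraph H G -> walk H x y -> walk G x y.
Proof. by move=> [_ b] [n [p [p0 pn pE]]]; exists n, p; split=> // i /pE /b. Qed.

Lemma walk_sym G x y : walk G x y -> walk G y x.
Proof.
move=> [n [p [p0 pn pE]]]; exists n, (fun i => p (n - i)%N).
rewrite subn0 subnn; split => // i ltin.
rewrite setUC; have -> : (n - i = (n - i.+1).+1)%N by rewrite subnSK.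
by apply: pE; rewrite subnSK // leq_subr.
Qed.

Lemma walk_trans G x y z : walk G x y -> walk G y z -> walk G x z.
Proof.
move=> [n [p [p0 pn pE]]] [m [q [q0 qm qE]]].
exists (n + m)%N, (fun i => if (i <= n)%N then p i else q (i - n)%N); split.
- by [].
- case: leqP => [h|_]; last by rewrite addKn.
  have m0 : m = 0%N by apply/eqP; rewrite -leqn0 -(leq_add2l n) addn0.
  by subst m; rewrite addn0 pn -q0.
- move=> i h; case: (ltnP i n) => [lin|]; first by rewrite ltnW //; exact: pE.
  rewrite leq_eqVlt => /orP[/eqP ni|lni].
    subst i; rewrite leqnn subSnn pn -q0; apply: qE.
    by rewrite -(ltn_add2l n) addn0.
  rewrite leqNgt lni /= subSn ?(ltnW lni) //; apply: qE.
  by rewrite ltn_subLR // ltnW.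
Qed.

Lemma edges_of_vertexP G x e :
  [set e | edges G e /\ e `<=` [set y | vertices G y /\ walk G x y]] e ->
  exists y z, [/\ [set y | vertices G y /\ walk G x y] y,
    [set y | vertices G y /\ walk G x y] z, y <> z & e = [set y; z]].
Proof.
move=> [/edgesP[y [z [Vy Vz yz ->]]] sub]; exists y, z.
by split => //; apply: sub; [left|right].
Qed.

Definition component_of G x : graph U := Graph (@edges_of_vertexP G x).

Lemma component_of_sub G x : subgraph (component_of G x) G.
Proof. by split => [y []|e []]. Qed.

Lemma edges_vertices G x y : edges G [set x; y] -> vertices G x /\ vertices G y.
Proof.
move=> /edgesP[a [b [Va Vb _ e]]].
have /= hx : [set a; b] x by rewrite -e; left.
have /= hy : [set a; b] y by rewrite -e; right.
by split; [case: hx|case: hy] => ->.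
Qed.

Lemma component_of_max G x C : vertices C x -> connected_graph C ->
  subgraph C G -> subgraph C (component_of G x).
Proof.
move=> Cx [_ cC] CG; have VC : vertices C `<=` vertices (component_of G x).
  by move=> y Cy; split; [exact: CG.1|exact/(walk_sub CG)/cC].
split => // e Ce; split; first exact: CG.2.
move: (edgesP Ce) => [a [b [Ca Cb _ ->]]].
by move=> y [->|->]; exact: VC.
Qed.

Lemma walk_component_of G x y :
  vertices G x -> walk G x y -> walk (component_of G x) x y.
Proof.
move=> Gx [n [p [p0 pn pE]]]; exists n, p; split => // i lin.
split; first exact: pE.
have W j : (j <= n)%N -> walk G x (p j).
  by move=> jn; exists j, p; split => // k kj; apply: pE; exact: leq_trans jn.
have [V1 V2] := edges_vertices (pE _ lin).
by move=> z [->|->]; split => //; apply: W => //; exact: ltnW.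
Qed.

Lemma component_ofP G x : vertices G x -> component (component_of G x) G.
Proof.
move=> Gx; have xx : vertices (component_of G x) x.
  by split => //; exists 0%N, (fun=> x).
split; first exact: component_of_sub.
  split; first by exists x.
  move=> y z [_ xy] [_ xz]; apply: (@walk_trans _ _ x).
    by apply/walk_sym; exact: walk_component_of.
  exact: walk_component_of.
by move=> C CG cC sC; apply: component_of_max => //; exact: sC.1.
Qed.

Lemma componentE G C x : component C G -> vertices C x -> C = component_of G x.
Proof.
move=> [CG cC maxC] Cx; have sC := component_of_max Cx cC CG.
apply: subgraph_anti => //; apply: maxC => //; first exact: component_of_sub.
by have [] := component_ofP (CG.1 _ Cx).
Qed.

Lemma component_uniq G C C' x : component C G -> component C' G ->
  vertices C x -> vertices C' x -> C = C'.
Proof. by move=> h h' /(componentE h) -> /(componentE h') ->. Qed.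

(* Two components containing tails of the same ray coincide. *)
Lemma component_ray_uniq G C C' r n m : component C G -> component C' G ->
  is_ray C (tail n r) -> is_ray C' (tail m r) -> C = C'.
Proof.
move=> h h' [a _ _] [b _ _]; apply: (@component_uniq _ _ _ (r (n + m)) h h').
  exact: a.
by rewrite addnC; exact: b.
Qed.

Lemma pair_inj r i j : injective r ->
  [set r i; r i.+1] = [set r j; r j.+1] -> i = j.
Proof.
move=> ri e.
have /= h1 : [set r j; r j.+1] (r i) by rewrite -e; left.
have /= h2 : [set r j; r j.+1] (r i.+1) by rewrite -e; right.
case: h1 => /ri // h1; case: h2 => /ri h2; last by case: h2.
by move: h1; rewrite -h2 => /eqP; rewrite -addn2 -{1}(addn0 i) eqn_add2l.
Qed.

Lemma ray_del_tail G r F : is_ray G r -> finite_set F ->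
  exists n, is_ray (del_edges G F) (tail n r).
Proof.
move=> [a b c] finF.
have : finite_set ((fun i => [set r i; r i.+1]) @^-1` F).
  by apply: finite_preimage => // i j _ _; exact: pair_inj.
case/finite_seqP => s sE; exists (\max_(i <- s) i).+1.
split => [i|i j /b /addnI //|i]; first exact: a.
rewrite /tail addnS; split; first exact: c.
set k := (_ + _)%N => Fk.
have : [set` s] k by rewrite -sE.
move=> /= ks; have := leq_bigmax_seq (F := id) (P := xpredT) k ks isT.
by rewrite leqNgt ltnS leq_addr.
Qed.

Lemma ray_component G r F : is_ray G r -> finite_set F ->
  exists C, component C (del_edges G F) /\ exists n, is_ray C (tail n r).
Proof.
move=> Gr /(ray_del_tail Gr)[n nr]; have [a b c] := nr.
exists (component_of (del_edges G F) (tail n r 0)); split.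
  exact: component_ofP.
have w i : walk (del_edges G F) (tail n r 0) (tail n r i).
  by exists i, (tail n r); split => // j _; exact: c.
have V i : vertices (component_of (del_edges G F) (tail n r 0)) (tail n r i).
  by split; [exact: a|exact: w].
exists n; split => // i; split; first exact: c.
by move=> y [->|->]; [exact: V|exact: (V i.+1)].
Qed.

Lemma edge_equiv_refl G r : is_ray G r -> edge_equiv G r r.
Proof.
by move=> Gr F finF _; have [C [h [n k]]] := ray_component Gr finF;
  exists C; split => //; exists n.
Qed.

Lemma edge_equiv_sym G r s : edge_equiv G r s -> edge_equiv G s r.
Proof. by move=> e F finF /(e _ finF)[C [a b c]]; exists C. Qed.

Lemma edge_equiv_trans G r s t :
  edge_equiv G r s -> edge_equiv G s t -> edge_equiv G r t.
Proof.
move=> e e' F finF FG; have [C [a b [n c]]] := e _ finF FG.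
have [C' [a' [m b'] c']] := e' _ finF FG; exists C; split => //.
by rewrite (component_ray_uniq a a' c b').
Qed.

Lemma end_component_ex G (eps : edge_end G) F : finite_set F ->
  F `<=` edges G -> exists C, end_component eps F C.
Proof.
move=> finF FG; have [r Gr er] := edge_endP eps.
have [C [hC [n rC]]] := ray_component Gr finF; exists C; split => // s.
rewrite er => -[Gs /(_ _ finF FG)[C' [hC' [m rC'] [k sC']]]].
by exists k; rewrite (component_ray_uniq hC hC' rC rC').
Qed.

Lemma end_component_uniq G (eps : edge_end G) F C C' :
  end_component eps F C -> end_component eps F C' -> C = C'.
Proof.
have [r Gr er] := edge_endP eps.
have epsr : end_rays eps r by rewrite er; split => //; exact: edge_equiv_refl.
move=> [hC /(_ _ epsr)[n rC]] [hC' /(_ _ epsr)[m rC']].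
exact: (component_ray_uniq hC hC' rC rC').
Qed.

Lemma end_nbhd_mono G (eps : edge_end G) F F' : F `<=` F' ->
  end_nbhd eps F' `<=` end_nbhd eps F.
Proof.
move=> FF' eta [C [[CG cC maxC] epsC] [r etar rC]].
have CF : subgraph C (del_edges G F).
  apply: subgraph_trans CG _; split => // e /= [Ge nF]; split => //.
  by move=> /FF'.
have [x Cx] := cC.1; have sC := component_of_max Cx cC CF.
exists (component_of (del_edges G F) x).
  split; first exact/component_ofP/CF.1.
  by move=> s /epsC[n sCn]; exists n; exact: is_ray_sub sCn.
by exists r => //; exact: is_ray_sub rC.
Qed.

Lemma end_openT G : @end_open G setT.
Proof. by move=> eps _; exists set0; split. Qed.

Lemma end_openI G : setI_closed (@end_open G).
Proof.
move=> A B oA oB eps [/oA[F [finF FG FA]] /oB[F' [finF' FG' FB]]].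
exists (F `|` F'); split; first by rewrite finite_setU.
  by move=> e [/FG|/FG'].
move=> eta h; split; [apply: FA|apply: FB]; apply: end_nbhd_mono h.
  exact: subsetUl.
exact: subsetUr.
Qed.

Lemma end_open_bigU G (I : Type) (f : I -> set (edge_end G)) :
  (forall i, end_open (f i)) -> end_open (\bigcup_i f i).
Proof.
move=> of_ eps [i _ /of_[F [finF FG Ff]]]; exists F; split => //.
by move=> eta /Ff; exists i.
Qed.

HB.instance Definition _ G := gen_eqMixin (edge_end G).
HB.instance Definition _ G := gen_choiceMixin (edge_end G).
HB.instance Definition _ G := isOpenTopological.Build (edge_end G)
  (@end_openT G) (@end_openI G) (@end_open_bigU G).

End Graphs.

Section Covering_properties.
Context (T : topologicalType).

Definition open_cover (W : set (set T)) :=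
  W `<=` open /\ \bigcup_(A in W) A = setT.

Definition menger := forall W : nat -> set (set T),
  (forall n, open_cover (W n)) ->
  exists F : nat -> set (set T),
    (forall n, finite_set (F n) /\ F n `<=` W n) /\
    \bigcup_n \bigcup_(A in F n) A = setT.

Definition lindelof := forall W : set (set T), open_cover W ->
  exists W' : set (set T), [/\ W' `<=` W, countable W' & open_cover W'].

Definition sigma_compact := exists K : nat -> set T,
  (forall n, compact (K n)) /\ \bigcup_n K n = setT.

(* [D : Type] is the subtype [set_type D] with the subspace topology. *)
Definition closed_discrete (D : set T) :=
  closed D /\ forall x : D, open [set x].

Definition D_space := forall W : T -> set T,
  (forall x, open (W x) /\ W x x) ->
  exists2 D : set T, closed_discrete D & \bigcup_(x in D) W x = setT.

End Covering_properties.

Definition homeomorphic (X Y : topologicalType) :=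
  exists (f : X -> Y) (g : Y -> X),
    [/\ cancel f g, cancel g f, continuous f & continuous g].

Definition has_closed_copy (X T : topologicalType) :=
  exists2 A : set T, closed A & homeomorphic X A.

Definition baire_space : topologicalType := prod_topology (fun _ : nat => nat).

(* Main.v *)
Require Import Defs.
From mathcomp Require Import all_boot all_classical topology.

Set Implicit Arguments.
Unset Strict Implicit.
Unset Printing Implicit Defensive.

Local Open Scope classical_set_scope.

(** The proof organises the edge-ends of G into a tree of clopen sets and then
    argues about that tree alone.

    A set C of vertices whose edge boundary is finite determines the clopen set
    of all edge-ends whose rays are eventually in C.  The nodes of the tree are
    the connected sets of this kind, below a root that stands for the whole
    graph and has the components of G as children.  A node C is divided at a
    vertex v in C.  Let [v] be the class of the vertices that no finite set of
    edges separates from v.  The rest of C splits into connected sets with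
    finite boundary, possibly infinitely many, in such a way that every edge-end
    of C lies in exactly one of them unless v dominates it, that is, unless v
    cannot be separated from it by finitely many edges ([children_cover]).  At most one
    edge-end is dominated by v, and a finite set of edges separates vertices of
    only finitely many pieces from v ([children_cofinite]).  So either the
    pieces partition the edge-ends of C, or they partition all but one of them
    and converge to the remaining one.  If v is always chosen in C at minimal
    distance from a fixed root of its component, then the nodes along a branch
    have no vertex in common ([pivot_function]); a nested sequence of connected
    sets with empty intersection carries a ray ([nested_ray]), and the edge-end
    of this ray has the sets along the branch as a neighbourhood base
    ([region_limit]).  These facts are the fields of [partition_tree], and
    [edge_end_tree] builds such a tree.

    Since branches converge, a property of nodes that holds for small
    neighbourhoods of every point and passes from the children of a node to the
    node holds everywhere ([bar_induction]).  This gives the D-property at once: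
    if a neighbourhood W x contains the whole node, choose x; otherwise take the
    union of the sets chosen in the children, and at a node with an exceptional
    edge-end e choose e too and ignore the children inside W e.

    It remains to see that a Lindelof edge-end space without a closed copy of
    the Baire space is sigma-compact, because sigma-compact spaces are Menger,
    Menger spaces are Lindelof, and a diagonal argument excludes closed copies
    of the Baire space from Menger spaces.  Suppose the whole space is not
    sigma-compact, and call a node sigma-compact if its set of edge-ends is.
    Below every node that is not sigma-compact there is a node without
    exceptional edge-end which has infinitely many children that are not
    sigma-compact: otherwise one gets countably many compact sets exhausting the
    node, the n-th of which keeps, from a sigma-compact child of a node that is
    not sigma-compact, the n-th compact piece, but nothing if the node has no
    exceptional edge-end and the child is not among its first n children; the
    compactness of these sets is again a bar induction
    ([sigma_part_of_thin]).  Choosing such nodes repeatedly yields a scheme of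
    clopen sets indexed by finite sequences of natural numbers, and the limits
    of its branches form a closed copy of the Baire space
    ([scheme_closed_copy]). *)

(** * Choice and finiteness *)

Lemma dependent_chain (T : Type) (P : T -> Prop) (R : T -> T -> Prop) (x0 : T) :
  P x0 -> (forall x, P x -> exists2 y, P y & R x y) ->
  exists s : nat -> T, s 0 = x0 /\ forall n, P (s n) /\ R (s n) (s n.+1).
Proof.
move=> P0 PR.
have /choice[f fP] : forall x, exists y, P x -> P y /\ R x y.
  by move=> x; have [/PR[y Py Rxy]|nPx] := pselect (P x); [exists y|exists x].
have Ps n : P (iter n f x0) by elim: n => //= n /fP[].
by exists (fun n => iter n f x0); split=> // n; split=> //; case: (fP _ (Ps n)).
Qed.

Lemma finite_uniform_bound (T : Type) (S : set T) (P : T -> nat -> Prop) :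
  finite_set S -> (forall x, S x -> exists n, P x n) ->
  (forall x m n, (m <= n)%N -> P x m -> P x n) ->
  exists n, forall x, S x -> P x n.
Proof.
move=> finS exP monoP.
have /choice[f fP] : forall x, exists n, S x -> P x n.
  by move=> x; have [/exP[n Pn]|nS] := pselect (S x); [exists n|exists 0%N].
have /finite_seqP[s sE] := finite_image f finS.
exists (\max_(i <- s) i)%N => x Sx; apply: monoP (fP _ Sx).
have sfx : [set` s] (f x) by rewrite -sE; exists x.
exact: (leq_bigmax_seq (F := id) (P := xpredT)).
Qed.

(** * Covers and compactness *)

Section Covers.
Context {X : topologicalType}.
Implicit Types (A B V : set X) (W : set (set X)).

(** Covers are indexed by themselves, as in the covering properties to be
    compared. *)
Definition finitely_covered W A :=
  exists2 W', finite_set W' & W' `<=` W /\ A `<=` \bigcup_(V in W') V.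

Lemma finitely_covered_sub W A B :
  A `<=` B -> finitely_covered W B -> finitely_covered W A.
Proof. by move=> AB [W' f [s c]]; exists W' => //; split => // x /AB /c. Qed.

Lemma finitely_covered1 W V : W V -> finitely_covered W V.
Proof.
by move=> WV; exists [set V] => //; split=> [_ ->//|x Vx]; exists V.
Qed.

Lemma finitely_covered0 W : finitely_covered W set0.
Proof. by exists set0 => //; split => // x []. Qed.

Lemma finitely_coveredU W A B :
  finitely_covered W A -> finitely_covered W B -> finitely_covered W (A `|` B).
Proof.
move=> [W1 f1 [s1 c1]] [W2 f2 [s2 c2]]; exists (W1 `|` W2).
  by rewrite finite_setU.
split=> [V [/s1|/s2]//|x [/c1|/c2] [V ? ?]]; exists V => //; first by left.
by right.
Qed.

Lemma finitely_covered_bigcup W (I : Type) (S : set I) (F : I -> set X) :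
  finite_set S -> (forall i, S i -> finitely_covered W (F i)) ->
  finitely_covered W (\bigcup_(i in S) F i).
Proof.
move=> finS FW.
have /choice[g gP] : forall i, exists W', S i ->
    [/\ finite_set W', W' `<=` W & F i `<=` \bigcup_(V in W') V].
  move=> i; have [/FW[W' f [s c]]|nS] := pselect (S i); last by exists set0.
  by exists W'.
exists (\bigcup_(i in S) g i); first by apply: bigcup_finite => // i /gP[].
split=> [V [i /gP[_ + _]]|x [i Si Fx]]; first exact.
by have [_ _ /(_ _ Fx)[V gV Vx]] := gP i Si; exists V => //; exists i.
Qed.

(** Compactness is defined by filters.  If A has no finite subcover from W,
    then the complements of finitely covered sets generate a filter on A without
    cluster point; conversely, a filter without cluster point in A yields the
    cover of A by the open sets that miss some member of the filter. *)
Lemma compact_finitely_coveredP A : compact A <->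
  forall W, W `<=` open -> A `<=` \bigcup_(V in W) V -> finitely_covered W A.
Proof.
split=> [cA W oW AW|AW F PF FA].
  apply: contrapT => nW.
  pose F : set_system X := [set B | finitely_covered W (A `\` B)].
  have FF : Filter F.
    split=> [|B C FB FC|B C BC]; rewrite /F /=.
    - by apply: finitely_covered_sub (finitely_covered0 W); rewrite setDT.
    - by rewrite setDIr; exact: finitely_coveredU.
    - by apply: finitely_covered_sub; exact: setDS.
  have PF : ProperFilter F.
    by split=> //; rewrite /F /= setD0.
  have FA : F A by rewrite /F /= setDv; exact: finitely_covered0.
  have [x [Ax clx]] := cA _ _ FA.
  have [V WV Vx] := AW _ Ax.
  have FV : F (~` V).
    apply: finitely_covered_sub (finitely_covered1 WV) => y [_ nVy].
    exact: contrapT.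
  have nV : nbhs x V by apply: open_nbhs_nbhs; split => //; exact: oW.
  by have [y []] := clx _ _ FV nV.
apply: contrapT => ncl.
pose W := [set V : set X | open V /\ exists2 B, F B & B `&` V = set0].
have oW : W `<=` open by move=> V [].
have [x Ax|W' finW' [W'W AW']] := AW W oW.
  apply: contrapT => nW; apply: ncl; exists x; split => // B V FB.
  rewrite nbhsE => -[O [oO Ox] OV].
  apply: contrapT => BV0; apply: nW; exists O => //; split => //.
  exists B => //; apply/seteqP; split => // y [By Oy]; apply: BV0.
  by exists y; split => //; exact: OV.
have /choice[g gP] : forall V, exists B, W' V -> F B /\ B `&` V = set0.
  move=> V; have [/W'W[_ [B FB BV]]|nV] := pselect (W' V); last by exists set0.
  by exists B.
have FI : F (\bigcap_(V in W') g V).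
  have /finite_fsetP[D DE] := finW'; rewrite DE.
  by apply: filter_bigI => V VD; have [] := gP V; rewrite // DE.
have [x [Ax gx]] := filter_ex (filterI FA FI).
have [V W'V Vx] := AW' _ Ax.
have [_ gV0] := gP _ W'V.
suff : set0 x by [].
by rewrite -gV0; split => //; exact: gx.
Qed.
End Covers.

(** * The implications valid in every space *)

Section Implications.
Context {X : topologicalType}.

Lemma sigma_compact_menger : sigma_compact X -> menger X.
Proof.
move=> [K [cK KT]] W covW.
have /choice[F FP] : forall n, exists F, finite_set F /\ F `<=` W n /\
    K n `<=` \bigcup_(A in F) A.
  move=> n; have [oW WT] := covW n.
  have [||F finF [FW KF]] := (compact_finitely_coveredP (K n)).1 (cK n) (W n).
  - exact: oW.
  - by rewrite WT.
  by exists F.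
exists F; split=> [n|]; first by have [? []] := FP n.
apply/seteqP; split => // x _; have : setT x by [].
by rewrite -KT => -[n _ /((FP n).2.2)]; exists n.
Qed.

(** Apply the Menger property to a constant sequence of covers. *)
Lemma menger_lindelof : menger X -> lindelof X.
Proof.
move=> mX W covW; have [F [FP FT]] := mX (fun=> W) (fun=> covW).
exists (\bigcup_n F n); split.
- by move=> A [n _ /((FP n).2)].
- apply: bigcup_countable; first exact: countableP.
  by move=> n _; apply: finite_set_countable; have [] := FP n.
split=> [A [n _ /((FP n).2)]|]; first by case: covW => + _; apply.
apply/seteqP; split => // x _; have : setT x by [].
by rewrite -FT => -[n _ [A FA Ax]]; exists A => //; exists n.
Qed.

(** The n-th cover consists of the open sets on which the n-th coordinate of
    the copy is constant.  Finitely many of its members bound the n-th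
    coordinate, and a sequence exceeding all these bounds is not covered. *)
Lemma menger_no_closed_baire : menger X -> ~ has_closed_copy baire_space X.
Proof.
move=> mX [A cA [f [g [fK gK cf cg]]]].
pose W n := [set V : set X | open V /\
  exists m, forall a : A, V (\val a) -> g a n = m].
have covW n : open_cover (W n).
  split=> [V []//|]; apply/seteqP; split => // x _.
  have [Ax|nAx] := pselect (A x); last first.
    exists (~` A) => //; split; first exact: closed_openC.
    by exists 0%N => -[a aA] /= /(_ (set_mem aA)).
  pose a : A := exist _ x (mem_set Ax).
  have : open [set b : A | g b n = g a n].
    have co : continuous (fun b : A => (g b : nat -> nat) n).
      move=> b; apply: (@continuous_comp _ _ _ g (fun h : baire_space => h n)).
        exact: cg.
      exact: (@proj_continuous nat (fun=> nat) n).
    have : open [set g a n] by exact: discrete_open.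
    by move/continuousP : co => /[apply].
  case=> V oV VE; exists V.
    split => //; exists (g a n) => b Vb.
    have : (\val @^-1` V) b by [].
    by rewrite VE.
  have : (\val @^-1` V) a by rewrite VE.
  by [].
have [F [FP FT]] := mX W covW.
have /choice[m mP] : forall n, exists m,
    forall V, F n V -> forall a : A, V (\val a) -> (g a n < m)%N.
  move=> n; apply: (@finite_uniform_bound _ (F n)
    (fun V m => forall a : A, V (\val a) -> (g a n < m)%N)).
  - by have [] := FP n.
  - move=> V /((FP n).2)[_ [m mP]]; exists m.+1 => a /mP ->; exact: leqnn.
  - by move=> V k l kl h a /h /leq_trans; apply.
have : setT (\val (f m)) by [].
rewrite -FT => -[n _ [V FV Vf]].
by have := mP n V FV (f m) Vf; rewrite fK ltnn.
Qed.
End Implications.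

(** * Trees of clopen sets *)

Inductive below (N : Type) (child : N -> N -> Prop) (c : N) : N -> Prop :=
| below_child k : child c k -> below child c k
| below_step k d : child c k -> below child k d -> below child c d.

(** The mark of a node is empty or consists of the exceptional point to which
    the children of the node converge.  Branches may skip levels in
    [branch_limit], which spares refining them when they are built. *)
Record partition_tree (X : topologicalType) := PartitionTree {
  node : Type;
  root : node;
  child : node -> node -> Prop;
  part : node -> set X;
  mark : node -> set X;
  part_root : part root = setT;
  part_clopen : forall c, clopen (part c);
  part_split : forall c, part c = mark c `|` \bigcup_(k in child c) part k;
  child_disjoint : forall c k l x,
    child c k -> child c l -> part k x -> part l x -> k = l;
  mark_child : forall c k x, child c k -> mark c x -> ~ part k x;
  mark_unique : forall c x y, mark c x -> mark c y -> x = y;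
  mark_cofinite : forall c x V, mark c x -> open V -> V x ->
    finite_set [set k | child c k /\ ~ part k `<=` V];
  branch_limit : forall s : nat -> node,
    (forall n, below child (s n) (s n.+1)) ->
    exists x, forall n, part (s n) x /\
      forall V, open V -> V x -> exists n, part (s n) `<=` V }.

Section Partition_trees.
Context {X : topologicalType} (t : partition_tree X).
Implicit Types (c d k l : node t) (x y : X).

Let below := below (@child X t).

Lemma part_open c : open (part c).
Proof. by have [] := part_clopen c. Qed.

Lemma part_closed c : closed (part c).
Proof. by have [] := part_clopen c. Qed.

Lemma child_sub c k : child c k -> part k `<=` part c.
Proof. by move=> ck x kx; rewrite part_split; right; exists k. Qed.

Lemma mark_sub c : mark c `<=` part c.
Proof. by move=> x cx; rewrite part_split; left. Qed.

Lemma below_sub c d : below c d -> part d `<=` part c.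
Proof.
elim=> {c d} [c k|c k d ck _ IH]; first exact: child_sub.
exact: subset_trans IH (child_sub ck).
Qed.

Lemma below_trans c d k : below c d -> below d k -> below c k.
Proof.
elim=> {c d} [c d cd dk|c e d ce _ IH /IH]; first exact: below_step dk.
exact: below_step.
Qed.

Definition weakly_below c d := c = d \/ below c d.

Lemma weakly_below_sub c d : weakly_below c d -> part d `<=` part c.
Proof. by move=> [->//|/below_sub]. Qed.

Lemma weakly_below_child c d k : weakly_below c d -> child d k -> below c k.
Proof.
move=> [->|cd] dk; first exact: below_child.
by apply: below_trans cd _; exact: below_child.
Qed.

Lemma below_cases c d : below c d ->
  exists2 k, child c k & weakly_below k d.
Proof.
by case=> [k ck|k e ck ke]; exists k => //; [left|right].
Qed.

(** The nodes containing a given point form a chain, since the children of a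
    node are disjoint. *)
Lemma weakly_below_total c d d' x :
  weakly_below c d -> weakly_below c d' -> part d x -> part d' x ->
  weakly_below d d' \/ weakly_below d' d.
Proof.
move=> [<-|cd]; first by left.
elim: cd d' => {c d} [c k ck|c k d ck kd IH] d' [<- _ _|/below_cases[l cl ld']].
- by right; right; exact: below_child.
- move=> kx d'x; left; suff -> : k = l by [].
  exact: child_disjoint ck cl kx (weakly_below_sub ld' d'x).
- by right; right; exact: below_step kd.
- move=> dx d'x; apply: IH => //; suff -> : k = l by [].
  exact: child_disjoint ck cl (below_sub kd dx) (weakly_below_sub ld' d'x).
Qed.

(** A node without the property has a child without it, and the limit of the
    resulting branch has a neighbourhood in which the property holds. *)
Lemma bar_induction (P : node t -> Prop) :
  (forall x, exists V, [/\ open V, V x &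
     forall c, part c x -> part c `<=` V -> P c]) ->
  (forall c, (forall k, child c k -> P k) -> P c) -> forall c, P c.
Proof.
move=> Ploc Pchild c; apply: contrapT => nPc.
have [|s [_ sP]] := @dependent_chain _ (fun d => ~ P d) (@child X t) c nPc.
  move=> d nPd; apply: contrapT => noc; apply: nPd; apply: Pchild => k dk.
  by apply: contrapT => nPk; apply: noc; exists k.
have [n|x xP] := @branch_limit X t s.
  by apply: below_child; have [] := sP n.
have [V [oV Vx VP]] := Ploc x; have [_ /(_ _ oV Vx)[n nV]] := xP 0%N.
by have [+ _] := sP n; apply; apply: VP nV; have [] := xP n.
Qed.

Lemma accessible_separation x y : accessible_space X -> x <> y ->
  exists V, [/\ open V, V x & ~ V y].
Proof.
move=> t1 /eqP /t1[V [oV]]; rewrite !inE => Vx nVy.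
by exists V; split => //; move: nVy; rewrite inE.
Qed.

Lemma finite_parts_closed (S : set (node t)) : finite_set S ->
  closed (\bigcup_(k in S) part k).
Proof.
move=> finS; rewrite -(bigcup_image S (@part X t) id).
apply: closed_bigcup; first exact: finite_image.
by move=> _ [k _ <-]; exact: part_closed.
Qed.

(** Bar induction on the existence of a locally finite choice D inside the node.
    Every point has a neighbourhood meeting D in at most that point, the
    form of closed discreteness that survives the union over the children; at an
    exceptional point e this holds because all but finitely many children lie in
    W e, and those are ignored. *)
Lemma tree_D_space : accessible_space X -> D_space X.
Proof.
move=> t1 W WP.
pose P c := exists2 D, D `<=` part c &
  (forall x, part c x ->
     exists V, [/\ open V, V x & forall y, D y -> V y -> y = x]) /\
  part c `<=` \bigcup_(x in D) W x.
have /(_ (root t))[D _ [Dloc DW]] : forall c, P c.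
  apply: bar_induction => [x|c IH].
    exists (W x); have [oW Wx] := WP x; split => // c cx cW.
    exists [set x]; first by move=> _ ->.
    split=> [y _|y /cW Wy]; last by exists x.
    have [->|/(accessible_separation t1)[V [oV Vy nVx]]] := pselect (y = x).
      by exists setT; split => //; exact: openT.
    by exists V; split => // _ ->.
  have /choice[Df DfP] : forall k, exists D, child c k -> D `<=` part k /\
      (forall x, part k x ->
        exists V, [/\ open V, V x & forall y, D y -> V y -> y = x]) /\
      part k `<=` \bigcup_(x in D) W x.
    by move=> k; have [/IH[D]|] := pselect (child c k); [exists D|exists set0].
  pose covered k := exists2 e, mark c e & part k `<=` W e.
  exists (mark c `|` \bigcup_(k in [set k | child c k /\ ~ covered k]) Df k).
    move=> x [/mark_sub//|[k [ck _] /((DfP k ck).1) kx]].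
    exact: child_sub ck _ kx.
  split=> x; rewrite part_split => -[cx|[k ck kx]].
  - have [oW Wx] := WP x.
    pose S := [set k | child c k /\ ~ part k `<=` W x].
    have finS : finite_set S by exact: mark_cofinite cx _ _.
    exists (W x `&` ~` \bigcup_(k in S) part k); split.
    + apply: openI => //; apply: closed_openC; exact: finite_parts_closed.
    + by split => // -[k [ck _] kx]; exact: mark_child ck cx kx.
    + move=> y [cy|[k [ck ncov] ky] [Wy nSy]]; first by move=> _; exact: mark_unique cy cx.
      exfalso; apply: nSy; exists k; last exact: (DfP k ck).1.
      by split => // kW; apply: ncov; exists x.
  - have [kD [kloc _]] := DfP k ck; have [V [oV Vx VD]] := kloc x kx.
    exists (V `&` part k); split => //; first by apply: openI => //; exact: part_open.
    move=> y [cy [_ ky]|[l [cl _] ly] [Vy ky]].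
      by have := mark_child ck cy ky.
    have kl : l = k := child_disjoint cl ck ((DfP l cl).1 _ ly) ky.
    by apply: VD => //; rewrite -kl.
  - by exists x; [left|have [] := WP x].
  - have [[e ce /(_ _ kx) We]|ncov] := pselect (covered k).
      by exists e => //; left.
    have [_ [_ /(_ _ kx)[y ky Wy]]] := DfP k ck.
    by exists y => //; right; exists k.
rewrite part_root in Dloc DW.
exists D; last by apply/seteqP; split.
split=> [|[x Dx]].
  rewrite -openC openE => x nDx.
  have [V [oV Vx VD]] := Dloc x Logic.I.
  rewrite /interior nbhsE; exists V => // y Vy Dy; apply: nDx.
  by rewrite -(VD y).
have [V [oV Vx VD]] := Dloc x Logic.I.
exists V => //; apply/seteqP; split=> [[y Dy] /= Vy|_ ->//].
by apply/val_inj/VD => //=; exact: set_mem.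
Qed.

(** * Sigma-compact nodes *)

(** The compact sets are taken increasing so that finitely many requirements of
    the form: x lies in the n-th set, can be met by one n. *)
Definition sigma_compact_set (A : set X) := exists K : nat -> set X,
  [/\ forall n, compact (K n), forall m n, (m <= n)%N -> K m `<=` K n &
      A = \bigcup_n K n].

Lemma sigma_compact_set_closed A B : sigma_compact_set A -> closed B ->
  B `<=` A -> sigma_compact_set B.
Proof.
move=> [K [cK mK AE]] cB BA; exists (fun n => K n `&` B); split.
- by move=> n; apply: compact_closedI.
- by move=> m n mn x [/(mK _ _ mn)].
- apply/seteqP; split=> [x Bx|x [n _ []//]].
  by have := BA x Bx; rewrite AE => -[n _ ?]; exists n.
Qed.

Definition sigma_part c := sigma_compact_set (part c).

Definition branching d :=
  mark d = set0 /\ infinite_set [set k | child d k /\ ~ sigma_part k].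

Lemma sigma_part_below c d : sigma_part c -> weakly_below c d -> sigma_part d.
Proof.
move=> gc cd; apply: sigma_compact_set_closed gc _ _; first exact: part_closed.
exact: weakly_below_sub.
Qed.

(** A point lies in at most one node at which sigma-compactness starts, because
    sigma-compactness is inherited by the nodes below. *)
Lemma first_sigma_part_unique c d d' k k' x :
  weakly_below c d -> weakly_below c d' -> ~ sigma_part d -> ~ sigma_part d' ->
  child d k -> child d' k' -> sigma_part k -> sigma_part k' -> part k x -> part k' x ->
  d = d' /\ k = k'.
Proof.
move=> cd cd' nd nd' dk dk' gk gk' kx k'x.
have no_below e e' l : ~ sigma_part e' -> child e l -> sigma_part l -> part l x ->
    part e' x -> ~ below e e'.
  move=> ne' el gl lx e'x /below_cases[m em me']; apply: ne'.
  apply: (sigma_part_below _ me'); suff <- : l = m by [].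
  exact: child_disjoint el em lx (weakly_below_sub me' e'x).
have dx := child_sub dk kx; have d'x := child_sub dk' k'x.
have dd' : d = d'.
  have [[->//|h]|[->//|h]] := weakly_below_total cd cd' dx d'x.
    by have := no_below _ _ _ nd' dk gk kx d'x h.
  by have := no_below _ _ _ nd dk' gk' k'x dx h.
by split => //; subst d'; exact: child_disjoint dk dk' kx k'x.
Qed.

(** The children of a node without exceptional point form, with the complement
    of the node, a partition of the space into open sets; a Lindelof space has
    only countable ones. *)
Lemma child_index d : lindelof X -> mark d = set0 ->
  exists j : node t -> nat, forall k l, child d k -> child d l ->
    part k !=set0 -> part l !=set0 -> j k = j l -> k = l.
Proof.
move=> lX md.
pose W := [set A | (exists2 k, child d k & A = part k) \/ A = ~` part d].
have [|W' [W'W cW' [_ W'T]]] := lX W.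
  split=> [A [[k _ ->]|->]|]; first exact: part_open.
    exact/closed_openC/part_closed.
  apply/seteqP; split => // x _; have [dx|ndx] := pselect (part d x).
    move: dx; rewrite part_split md set0U => -[k dk kx].
    by exists (part k) => //; left; exists k.
  by exists (~` part d) => //; right.
have /countable_injP[j j_inj] := cW'.
have W'part k : child d k -> part k !=set0 -> W' (part k).
  move=> dk [x kx]; have : setT x by [].
  rewrite -W'T => -[A W'A Ax]; have [[l dl Al]|Ad] := W'W _ W'A.
    by rewrite Al in Ax W'A; rewrite (child_disjoint dk dl kx Ax).
  by rewrite Ad in Ax; have := Ax (child_sub dk kx).
exists (fun k => j (part k)) => k l dk dl k0 l0 jkl.
have kl : part k = part l.
  by apply: j_inj jkl; rewrite inE; exact: W'part.
have [x kx] := k0; have lx : part l x by rewrite -kl.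
exact: child_disjoint dk dl kx lx.
Qed.

(** The set Z n omits a point x of c if x lies in a sigma-compact child k of a
    node d that is not sigma-compact, and either x is not in the n-th compact
    piece of k, or d has no exceptional point and the index of k exceeds n.
    Each x has at most one such k, so the sets Z n exhaust c.  They are compact:
    by bar induction, a cover of Z n has a finite subcover on each node d below c
    that is not sigma-compact.  If d has an exceptional point, then a cover
    element around it takes care of all but finitely many children; otherwise
    only the finitely many children with index at most n and the finitely many
    children that are not sigma-compact meet Z n. *)
Lemma sigma_part_of_thin c : lindelof X ->
  (forall d, weakly_below c d -> ~ branching d) -> sigma_part c.
Proof.
move=> lX thin; apply: contrapT => ngc.
have /choice[K KP] : forall k, exists K : nat -> set X, sigma_part k ->
    [/\ forall n, compact (K n), forall m n, (m <= n)%N -> K m `<=` K n &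
        part k = \bigcup_n K n].
  by move=> k; have [[K]|] := pselect (sigma_part k); [exists K|exists (fun=> set0)].
have /choice[j jP] : forall d, exists j : node t -> nat, mark d = set0 ->
    forall k l, child d k -> child d l ->
    part k !=set0 -> part l !=set0 -> j k = j l -> k = l.
  move=> d; have [md|] := pselect (mark d = set0); last by exists (fun=> 0%N).
  by have [i] := child_index lX md; exists i.
pose leaves d k x :=
  [/\ weakly_below c d, ~ sigma_part d, child d k, sigma_part k & part k x].
pose late n d k x := ~ K k n x \/ mark d = set0 /\ (n < j d k)%N.
pose Z n := [set x | part c x /\ forall d k, leaves d k x -> ~ late n d k x].
suff gc : sigma_part c by [].
exists Z; split; last 1 first.
- apply/seteqP; split=> [x cx|x [n _ []//]].
  have [[d [k dkx]]|no] := pselect (exists d k, leaves d k x); last first.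
    by exists 0%N => //; split => // d k h; case: no; exists d, k.
  have [cd nd dk gk kx] := dkx; have [_ mK kK] := KP k gk.
  move: (kx); rewrite kK => -[m _ Kmx].
  exists (maxn m (j d k)) => //; split => // d' k' [cd' nd' dk' gk' kx'].
  have [<- <-] := first_sigma_part_unique cd cd' nd nd' dk dk' gk gk' kx kx'.
  move=> [|[_]]; last by rewrite ltnNge leq_maxr.
  by apply; apply: mK Kmx; exact: leq_maxl.
- move=> n; apply/compact_finitely_coveredP => W oW ZW.
  suff P d : weakly_below c d -> ~ sigma_part d -> finitely_covered W (Z n `&` part d).
    apply: finitely_covered_sub (P c _ ngc); last by left.
    by move=> x [cx ?]; split.
  apply: (bar_induction (P := fun d => weakly_below c d -> ~ sigma_part d ->
      finitely_covered W (Z n `&` part d))) => [x|{}d IH cd nd].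
    have [/ZW[V WV Vx]|nZx] := pselect (Z n x).
      exists V; split => //; first exact: oW.
      move=> d' _ d'V _ _; apply: finitely_covered_sub (finitely_covered1 WV).
      by move=> y [_ /d'V].
    have [cx|ncx] := pselect (part c x); last first.
      exists (~` part c); split => //; first exact/closed_openC/part_closed.
      by move=> d' d'x _ /weakly_below_sub /(_ _ d'x).
    have [[d' [k [[_ _ _ gk kx] _]]]|no] :=
        pselect (exists d k, leaves d k x /\ late n d k x); last first.
      exfalso; apply: nZx; split => // d' k h l.
      by apply: no; exists d', k.
    exists (part k); split => //; first exact: part_open.
    move=> e _ ek _ []; apply: sigma_compact_set_closed gk _ ek.
    exact: part_closed.
  have fc_sigma k : child d k -> sigma_part k -> (mark d = set0 -> (j d k <= n)%N) ->
      finitely_covered W (Z n `&` part k).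
    move=> dk gk jk; have [cK mK kK] := KP k gk.
    (* The n-th piece must lie in Z n, as W is only known to cover Z n. *)
    have KZ : K k n `<=` Z n.
      move=> x Kx; have kx : part k x by rewrite kK; exists n.
      split=> [|d' k' [cd' nd' dk' gk' kx']].
        exact: weakly_below_sub cd _ (child_sub dk kx).
      have [<- <-] := first_sigma_part_unique cd cd' nd nd' dk dk' gk gk' kx kx'.
      by move=> [//|[/jk]]; rewrite leqNgt => /negP.
    apply: finitely_covered_sub (_ : finitely_covered W (K k n)).
      move=> x [[_ /(_ d k) Zx] kx]; apply: contrapT => nK.
      by apply: Zx; [split|left].
    by apply: (compact_finitely_coveredP _).1 => // x /KZ /ZW.
  have [[e de]|md] := pselect (mark d !=set0).
    (* The exceptional point of d lies in no child, so Z n does not omit it. *)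
    have Ze : Z n e.
      split=> [|d' k [cd' nd' d'k gk ke]].
        exact: weakly_below_sub cd _ (mark_sub de).
      have [[dd'|/below_cases[l dl ld']]|[d'd|/below_cases[l d'l ld]]] :=
        weakly_below_total cd cd' (mark_sub de) (child_sub d'k ke).
      + by subst d'; have := mark_child d'k de ke.
      + have := mark_child dl de.
        by move/(_ (weakly_below_sub ld' (child_sub d'k ke))).
      + by subst d'; have := mark_child d'k de ke.
      + exfalso; apply: nd; apply: (sigma_part_below _ ld); suff <- : k = l by [].
        exact: child_disjoint d'k d'l ke (weakly_below_sub ld (mark_sub de)).
    have [V WV Ve] := ZW e Ze.
    pose S := [set k | child d k /\ ~ part k `<=` V].
    have finS : finite_set S by exact: mark_cofinite de (oW _ WV) Ve.
    apply: finitely_covered_sub (finitely_coveredU (finitely_covered1 WV)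
      (finitely_covered_bigcup (F := fun k => Z n `&` part k) finS _)).
      move=> x [Zx]; rewrite part_split => -[dx|[k dk kx]].
        by left; rewrite (mark_unique dx de).
      have [kV|nkV] := pselect (part k `<=` V); first by left; exact: kV.
      by right; exists k.
    move=> k [dk _]; have [gk|ngk] := pselect (sigma_part k).
      by apply: fc_sigma => // md0; rewrite md0 in de.
    by apply: IH => //; right; exact: weakly_below_child cd dk.
  have {}md : mark d = set0.
    by apply/seteqP; split=> // x dx; apply: md; exists x.
  pose S1 := [set k | child d k /\ ~ sigma_part k].
  pose S2 := [set k | [/\ child d k, sigma_part k, part k !=set0 & (j d k <= n)%N]].
  have finS1 : finite_set S1.
    by apply: contrapT => infS; apply: (thin d cd).
  have finS2 : finite_set S2.
    rewrite -(eq_finite_set (_ : j d @` S2 #= S2)%card).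
      apply: sub_finite_set (finite_II n.+1).
      by move=> _ [k [_ _ _ jk] <-].
    apply: inj_card_eq => k l; rewrite !inE => -[dk _ k0 _] [dl _ l0 _].
    exact: (jP d md).
  have finS : finite_set (S1 `|` S2) by rewrite finite_setU.
  apply: finitely_covered_sub
    (finitely_covered_bigcup (F := fun k => Z n `&` part k) finS _).
    move=> x [Zx]; rewrite part_split md set0U => -[k dk kx].
    exists k => //; have [gk|ngk] := pselect (sigma_part k); last by left.
    right; split => //; first by exists x.
    rewrite leqNgt; apply/negP => nj.
    by have [_ /(_ d k)] := Zx; apply; [split|right].
  move=> k [[dk ngk]|[dk gk _ jk]]; last exact: fc_sigma.
  by apply: IH => //; right; exact: weakly_below_child cd dk.
- move=> m n mn x [cx Zx]; split => // d k h [nK|[md nj]].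
    have [_ _ _ gk _] := h; have [_ mK _] := KP k gk.
    by apply: (Zx d k h); left => /(mK _ _ mn).
  by apply: (Zx d k h); right; split => //; exact: leq_ltn_trans nj.
Qed.

Lemma branching_below c : lindelof X -> ~ sigma_part c ->
  exists2 d, weakly_below c d & branching d.
Proof.
move=> lX ngc; apply: contrapT => nobr; apply: ngc.
apply: sigma_part_of_thin => // d cd fd.
by apply: nobr; exists d.
Qed.

(** * Closed copies of the Baire space *)

Lemma infinite_injection (T : Type) (S : set T) : infinite_set S ->
  exists f : nat -> T, injective f /\ forall n, S (f n).
Proof.
move=> /infiniteP/card_leP[f].
pose n0 (n : nat) : [set: nat] := SigSub (mem_set (Logic.I : [set: nat] n)).
exists (fun n => \val (f (n0 n))); split=> [m n /val_inj fmn|n].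
  have : n0 m = n0 n by apply: 'inj_f => //; rewrite inE.
  by move=> /(congr1 \val).
exact: set_valP.
Qed.

Section Baire_scheme.
Variables (base : node t -> node t) (sel : node t -> nat -> node t).

(** [base c] plays the role of a branching node below c and [sel c] that of an
    injective enumeration of some of its children. *)
Fixpoint scheme (h : nat -> nat) n :=
  if n is m.+1 then sel (scheme h m) (h m) else root t.

Hypothesis base_below : forall h n, weakly_below (scheme h n) (base (scheme h n)).
Hypothesis base_mark : forall h n, mark (base (scheme h n)) = set0.
Hypothesis sel_child : forall h n i, child (base (scheme h n)) (sel (scheme h n) i).
Hypothesis sel_inj : forall h n, injective (sel (scheme h n)).

Lemma eq_scheme h g n : (forall m, (m < n)%N -> h m = g m) ->
  scheme h n = scheme g n.
Proof.
elim: n => //= n IH hg; rewrite IH ?hg // => m mn; apply: hg.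
exact: leq_trans mn _.
Qed.

Lemma scheme_below h n : below (scheme h n) (scheme h n.+1).
Proof. by apply: weakly_below_child; [exact: base_below|exact: sel_child]. Qed.

Lemma scheme_sub h n m : (m <= n)%N -> part (scheme h n) `<=` part (scheme h m).
Proof.
elim: n => [|n IH]; first by rewrite leqn0 => /eqP ->.
rewrite leq_eqVlt => /orP[/eqP -> //|/IH]; apply: subset_trans.
exact/below_sub/scheme_below.
Qed.

Lemma scheme_agree h g n x : part (scheme h n) x -> part (scheme g n) x ->
  forall m, (m < n)%N -> h m = g m.
Proof.
move=> hx gx m; elim/ltn_ind: m => m IH mn.
have E : scheme h m = scheme g m.
  by apply: eq_scheme => i im; apply: IH => //; exact: ltn_trans mn.
have /= hmx := scheme_sub mn hx; have /= gmx := scheme_sub mn gx.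
apply: (@sel_inj h m); rewrite {2}E.
apply: child_disjoint hmx gmx; first exact: sel_child.
by rewrite E; exact: sel_child.
Qed.

Lemma cylinder_nbhs (h : baire_space) n :
  nbhs h [set g : baire_space | forall m, (m < n)%N -> g m = h m].
Proof.
elim: n => [|n IH]; first by apply: filterS filterT.
have : nbhs h [set g : baire_space | g n = h n].
  have cn := @proj_continuous nat (fun=> nat) n h.
  have /cn : nbhs (proj n h) [set h n].
    by apply: open_nbhs_nbhs; split => //; exact: discrete_open.
  by [].
apply: filterS2 IH => g gh ghn m.
by rewrite ltnS leq_eqVlt => /orP[/eqP ->|/gh].
Qed.

(** Sending h to the limit of the nodes [scheme h n] is a homeomorphism onto its
    range because these nodes form a base at the limit and determine h.  A point
    x outside the range belongs to a last node [scheme h n]; it is outside the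
    node [base] below it or, as that node has no exceptional point, in one of its
    children that is not selected, and each of these two sets is open and
    contains no limit. *)
Lemma scheme_closed_copy : accessible_space X -> has_closed_copy baire_space X.
Proof.
move=> t1.
have /choice[lim limP] : forall h, exists x, forall n, part (scheme h n) x /\
    forall V, open V -> V x -> exists n, part (scheme h n) `<=` V.
  by move=> h; apply: branch_limit => n; exact: scheme_below.
have in_lim h n : part (scheme h n) (lim h) by have [] := limP h n.
have lim_base h V : open V -> V (lim h) -> exists n, part (scheme h n) `<=` V.
  by have [_] := limP h 0%N; apply.
have lim_eq h x : (forall n, part (scheme h n) x) -> x = lim h.
  move=> hx; apply: contrapT => /nesym /(accessible_separation t1)[V [oV Vh nVx]].
  by have [n /(_ _ (hx n))] := lim_base h V oV Vh.
pose A := range lim; exists A.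
  rewrite -openC openE => x nAx.
  (* Otherwise the sequences witnessing each level agree with their diagonal. *)
  have [n nx] : exists n, forall h, ~ part (scheme h n) x.
    apply: contrapT => nn.
    have /choice[g gP] : forall n, exists h, part (scheme h n) x.
      move=> n; apply: contrapT => nh; apply: nn; exists n => h hx.
      by apply: nh; exists h.
    apply: nAx; exists (fun n => g n.+1 n) => //; apply/esym/lim_eq => n.
    rewrite (@eq_scheme _ (g n)) // => m mn.
    apply: (scheme_agree (n := m.+1) (x := x)) => //.
    exact: scheme_sub mn _ (gP n).
  elim: n nx => [/(_ (fun=> 0%N))|n IH nx].
    by rewrite /= part_root => /(_ Logic.I).
  have [[h hx]|nh] := pselect (exists h, part (scheme h n) x); last first.
    by apply: IH => h hx; apply: nh; exists h.
  set d := base (scheme h n).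
  have limd g : part (scheme h n) (lim g) ->
      child d (scheme g n.+1).
    move=> hg; have E : scheme g n = scheme h n.
      by apply: eq_scheme => m mn; apply/esym; exact: scheme_agree hg _ _ mn.
    by rewrite /= E; exact: sel_child.
  have [dx|ndx] := pselect (part d x); last first.
    rewrite /interior nbhsE.
    exists (part (scheme h n) `&` ~` part d) => [|y [hy ndy] [g _ gy]].
      split => //; apply: openI; first exact: part_open.
      exact/closed_openC/part_closed.
    subst y; apply: ndy; exact: child_sub (limd g hy) _ (in_lim g n.+1).
  move: (dx); rewrite part_split /d base_mark set0U => -[k dk kx].
  rewrite /interior nbhsE; exists (part k).
    by split => //; exact: part_open.
  move=> y ky [g _ gy]; subst y.
  have hg : part (scheme h n) (lim g).
    apply: weakly_below_sub (base_below h n) _ _.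
    exact: child_sub dk _ ky.
  apply: (nx g); rewrite (child_disjoint (limd g hg) dk (in_lim g n.+1) ky).
  exact: kx.
pose f h : A := SigSub (mem_set (ex_intro2 _ _ h Logic.I erefl : A (lim h))).
have /choice[g gP] : forall a : A, exists h, lim h = \val a.
  by move=> a; have [h _ ha] := set_valP a; exists h.
have gE h (a : A) n : part (scheme h n) (\val a) ->
    forall m, (m < n)%N -> g a m = h m.
  move=> ha; apply: scheme_agree ha => //; by rewrite -gP; exact: in_lim.
exists f, g; split.
- move=> h; apply/funext => n; apply: (gE _ _ n.+1) => //; exact: in_lim.
- by move=> a; apply: val_inj; rewrite /= gP.
- apply: (@continuous_comp_initial A baire_space X set_val f) => h V.
  rewrite nbhsE => -[O [oO Oh] OV].
  have [n nO] := lim_base h O oO Oh.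
  apply: filterS (cylinder_nbhs h n) => g' hg'; apply/OV/nO.
  rewrite -(@eq_scheme g' h n) //; exact: in_lim.
- move=> a; apply/cvg_sup => [|n]; first exact/fmap_filter/nbhs_filter.
  move: a.
  apply: (@continuous_comp_initial _ _ _ (fun h : nat -> nat => h n) g).
  move=> a V /= nV.
  have na : nbhs a (set_val @^-1` part (scheme (g a) n.+1)).
    apply: initial_continuous; apply: open_nbhs_nbhs; split.
      exact: part_open.
    by rewrite -[set_val a]gP; exact: in_lim.
  apply: filterS na => b /gE /(_ n (ltnSn n)) /= ->.
  exact: nbhs_singleton nV.
Qed.
End Baire_scheme.

Lemma tree_sigma_compact : accessible_space X -> lindelof X ->
  ~ has_closed_copy baire_space X -> sigma_compact X.
Proof.
move=> t1 lX nB.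
suff [K [cK _ KT]] : sigma_part (root t) by exists K; split; rewrite // -KT part_root.
apply: contrapT => nroot; apply: nB.
have /choice[p pP] : forall c, exists p : node t * (nat -> node t), ~ sigma_part c ->
    [/\ weakly_below c p.1, mark p.1 = set0, injective p.2 &
        forall i, child p.1 (p.2 i) /\ ~ sigma_part (p.2 i)].
  move=> c; have [gc|ngc] := pselect (sigma_part c); first by exists (c, fun=> c).
  have [d cd [md /infinite_injection[f [f_inj fP]]]] := branching_below lX ngc.
  by exists (d, f).
pose base c := (p c).1; pose sel c := (p c).2.
have bad h n : ~ sigma_part (scheme sel h n).
  by elim: n => //= n /pP[_ _ _ /(_ (h n))[]].
apply: (@scheme_closed_copy base sel) => // h n.
- by have [] := pP _ (bad h n).
- by have [] := pP _ (bad h n).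
- by move=> i; have [_ _ _ /(_ i)[]] := pP _ (bad h n).
- by have [] := pP _ (bad h n).
Qed.

End Partition_trees.

(** * Walks, boundaries and rays *)

Section Graph_walks.
Context {U : Type} (G : graph U).
Implicit Types (A B C K : set U) (F H : set (set U)) (x y v : U) (r s : nat -> U).

Lemma walk_invariant (H : graph U) (P : U -> Prop) x y : P x ->
  (forall a b, P a -> edges H [set a; b] -> P b) -> walk H x y -> P y.
Proof.
move=> Px Pstep [n [p [p0 <- pE]]].
suff : forall i, (i <= n)%N -> P (p i) by apply.
elim=> [_|i IH lin]; first by rewrite p0.
by apply: Pstep (pE i lin); exact/IH/ltnW.
Qed.

Lemma walk_edge (H : graph U) x y : edges H [set x; y] -> walk H x y.
Proof. by move=> xy; exists 1%N, (fun i => if i is 0 then x else y); split=> // -[]. Qed.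

Lemma within_edgesP A F e :
  [set e | [/\ edges G e, ~ F e & e `<=` A]] e ->
  exists x y, [/\ (vertices G `&` A) x, (vertices G `&` A) y, x <> y & e = [set x; y]].
Proof.
move=> [/edgesP[x [y [Vx Vy xy ->]]] _ eA]; exists x, y.
by split => //; split => //; apply: eA; [left|right].
Qed.

(** The subgraph induced on A without the edges of F.  Almost all connectivity
    statements are about walks in such a subgraph. *)
Definition within A F : graph U := Graph (@within_edgesP A F).

Definition link A F x y := walk (within A F) x y.

Definition comp A F x := [set y | link A F x y].

Definition connected_set C := forall x y, C x -> C y -> link C set0 x y.

Definition finite_cut F := finite_set F /\ F `<=` edges G.

Definition endpoints F := \bigcup_(e in F) e.

Definition boundary C :=
  [set e | edges G e /\ exists x y, [/\ C x, ~ C y & e = [set x; y]]].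

Lemma link_refl A F x : link A F x x.
Proof. by exists 0%N, (fun=> x). Qed.

Lemma link_sym A F x y : link A F x y -> link A F y x.
Proof. exact: walk_sym. Qed.

Lemma link_trans A F x y z : link A F x y -> link A F y z -> link A F x z.
Proof. exact: walk_trans. Qed.

Lemma link_sub A B F F' x y : A `<=` B -> F' `<=` F -> link A F x y -> link B F' x y.
Proof.
move=> AB FF'; apply: walk_sub; split=> [z [Vz /AB]//|e [Ge nFe eA]].
by split => //; [move/FF'|exact: subset_trans AB].
Qed.

Lemma link_edge A F x y : edges G [set x; y] -> ~ F [set x; y] -> A x -> A y ->
  link A F x y.
Proof. by move=> Gxy nF Ax Ay; apply: walk_edge; split => // z [->|->]. Qed.

Lemma link_in A F x y : A x -> link A F x y -> A y.
Proof. by move=> Ax; apply: walk_invariant => // a b _ [_ _]; apply; right. Qed.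

Lemma link_vertex A F x y : vertices G x -> link A F x y -> vertices G y.
Proof.
move=> Vx; apply: (walk_invariant (P := vertices G)) => // a b _ [Gab _ _].
by have [] := edges_vertices Gab.
Qed.

Lemma link_comp A F x y : link A F x y -> link (comp A F x) F x y.
Proof.
move=> xy; suff [] : link A F x y /\ link (comp A F x) F x y by [].
apply: (walk_invariant (P := fun y => link A F x y /\ link (comp A F x) F x y) _ _ xy).
  by split; exact: link_refl.
move=> a b [xa cxa] ab; have xb : link A F x b.
  by apply: link_trans xa _; exact: walk_edge.
split => //; apply: link_trans cxa _.
by have [Gab nF _] := ab; exact: link_edge.
Qed.

Lemma comp_linked A F x y z : comp A F x y -> comp A F x z ->
  link (comp A F x) F y z.
Proof.
move=> /link_comp xy /link_comp xz; apply: link_trans xz; exact: link_sym.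
Qed.

Lemma comp_connected A F x : connected_set (comp A F x).
Proof. by move=> y z xy xz; apply: link_sub (comp_linked xy xz). Qed.

Lemma comp_eq A F x y : link A F x y -> comp A F x = comp A F y.
Proof.
move=> xy; apply/seteqP; split=> z /= h; last exact: link_trans xy h.
exact: link_trans (link_sym xy) h.
Qed.

Lemma finite_cutU F F' : finite_cut F -> finite_cut F' -> finite_cut (F `|` F').
Proof.
by move=> [a b] [c d]; split; [rewrite finite_setU|move=> e [/b|/d]].
Qed.

Lemma finite_cut_bigcup (I : Type) (S : set I) (F : I -> set (set U)) :
  finite_set S -> (forall i, finite_cut (F i)) -> finite_cut (\bigcup_(i in S) F i).
Proof.
move=> finS cF; split; first by apply: bigcup_finite => // i _; have [] := cF i.
by move=> e [i _ Fe]; have [_] := cF i; apply.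
Qed.

Lemma finite_endpoints F : finite_cut F -> finite_set (endpoints F).
Proof.
move=> [finF FG]; apply: bigcup_finite => // e /FG /edgesP[x [y [_ _ _ ->]]].
exact: finite_set2.
Qed.

Lemma boundary_cut C : finite_set (boundary C) -> finite_cut (boundary C).
Proof. by move=> fC; split => // e []. Qed.

Lemma connected_avoid C F x y : connected_set C ->
  (forall z, C z -> ~ endpoints F z) -> C x -> C y -> link C F x y.
Proof.
move=> cC CF Cx Cy; apply: walk_sub (cC x y Cx Cy).
split=> // e [Ge _ eC]; split => // Fe; have [a [b [_ _ _ E]]] := edgesP Ge.
have ea : e a by rewrite E; left.
by apply: (CF a); [exact: eC|exists e].
Qed.

Lemma link_stay A C F x y : boundary C `<=` F -> link A F x y -> C x -> C y.
Proof.
move=> bF xy Cx; apply: (walk_invariant (P := C) Cx _ xy) => a b Ca [Gab nF _].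
apply: contrapT => nCb; apply: nF; apply: bF; split => //.
by exists a, b.
Qed.

(** Deleting finitely many edges from a connected graph leaves finitely many
    components, as each one contains x0 or an endpoint of a deleted edge. *)
Lemma finite_comps K F x0 : connected_set K -> K x0 -> finite_cut F ->
  finite_set [set comp K F x | x in K].
Proof.
move=> cK Kx0 cF.
apply: (@sub_finite_set _ _ (comp K F @` (x0 |` (endpoints F)))); last first.
  apply: finite_image; rewrite finite_setU; split; first exact: finite_set1.
  exact: finite_endpoints.
move=> _ [x Kx <-]; suff [s Ss sx] : exists2 s, (x0 |` endpoints F) s & link K F s x.
  by exists s => //; exact: comp_eq.
apply: (walk_invariant (P := fun x => exists2 s, (x0 |` endpoints F) s &
  link K F s x) _ _ (cK x0 x Kx0 Kx)) => [|a b [s Ss sa] [Gab _ abK]].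
  by exists x0; [left|exact: link_refl].
have [Fab|nFab] := pselect (F [set a; b]).
  by exists b; [right; exists [set a; b] => //; right|exact: link_refl].
exists s => //; apply: link_trans sa _.
by apply: link_edge => //; apply: abK; [left|right].
Qed.

(** The distance to T, characterised by descent: a vertex outside T from which T
    can be reached has a neighbour closer to T. *)
Lemma distance_function (H : graph U) (T : set U) : exists d : U -> nat,
  forall x, (exists2 z, T z & walk H x z) ->
    T x \/ exists y, [/\ edges H [set x; y], (d y < d x)%N &
                         exists2 z, T z & walk H y z].
Proof.
pose reach n x := exists p : nat -> U,
  [/\ p 0%N = x, T (p n) & forall i, (i < n)%N -> edges H [set p i; p i.+1]].
have /choice[d dP] : forall x, exists n, (exists2 z, T z & walk H x z) ->
    reach n x /\ forall m, reach m x -> (n <= m)%N.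
  move=> x; have [xT|] := pselect (exists2 z, T z & walk H x z); last by exists 0%N.
  have ex : exists n, `[< reach n x >].
    have [z Tz [n [p [p0 pn pE]]]] := xT; exists n; apply/asboolP.
    by exists p; split; rewrite ?pn.
  case: (ex_minnP ex) => n /asboolP xn minn; exists n => _; split => // m xm.
  by apply: minn; exact/asboolP.
exists d => x xT; have [[p [p0 Tp pE]] _] := dP x xT.
case E : (d x) Tp pE => [|n] Tp pE; first by left; rewrite -p0.
right; exists (p 1%N).
have reach1 : reach n (p 1%N).
  by exists (fun i => p i.+1); split => // i ltin; exact: (pE i.+1).
have y1 : exists2 z, T z & walk H (p 1%N) z.
  exists (p n.+1) => //; exists n, (fun i => p i.+1).
  by split => // i ltin; exact: (pE i.+1).
split => //; first by rewrite -p0; exact: pE.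
by have [_ /(_ _ reach1)] := dP _ y1.
Qed.

(** The level of a vertex is the last n such that it lies in Z n.  A vertex has a
    neighbour that has a higher level, or the same level and a smaller distance
    to the next set.  Following such neighbours never repeats a vertex, and the
    level tends to infinity because the distance cannot decrease forever. *)
Lemma nested_ray (Z : nat -> set U) :
  (forall n, Z n.+1 `<=` Z n) -> (forall n, Z n !=set0) ->
  (forall n, connected_set (Z n)) -> Z 0 `<=` vertices G ->
  (forall x, exists n, ~ Z n x) ->
  exists2 r, is_ray G r & forall n, exists N, forall i, (N <= i)%N -> Z n (r i).
Proof.
move=> decZ neZ cZ ZV capZ.
have monoZ m n : (m <= n)%N -> Z n `<=` Z m.
  elim: n => [|n IH]; first by rewrite leqn0 => /eqP ->.
  by rewrite leq_eqVlt => /orP[/eqP -> //|/IH]; apply: subset_trans.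
have /choice[lev levP] : forall x, exists n, Z 0 x -> Z n x /\ ~ Z n.+1 x.
  move=> x; have ex : exists n, `[< ~ Z n x >].
    by have [n nZ] := capZ x; exists n; exact/asboolP.
  case: (ex_minnP ex) => -[|n] /asboolP nZ minn; first by exists 0%N.
  exists n => _; split => //; apply: contrapT => /asboolP /minn.
  by rewrite ltnn.
have lev_ge n x : Z n x -> (n <= lev x)%N.
  move=> Zx; rewrite leqNgt; apply/negP => lt.
  have [_] := levP x (monoZ _ _ (leq0n n) _ Zx); apply; exact: monoZ Zx.
have /choice[d dP] := fun n => distance_function (within (Z n) set0) (Z n.+1).
pose prec x y := (lev x < lev y)%N \/ lev y = lev x /\ (d (lev x) y < d (lev x) x)%N.
have [x0 Zx0] := neZ 0%N.
have [|s [s0 sP]] := @dependent_chain _ (Z 0)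
    (fun x y => edges G [set x; y] /\ prec x y) x0 Zx0.
  move=> x Zx; have [Zl nZl] := levP x Zx.
  have [|//|[y [[Gxy _ xyZ] dyx _]]] := dP (lev x) x.
    have [z Zz] := neZ (lev x).+1; exists z => //.
    by apply: cZ => //; exact: decZ.
  have Zy : Z (lev x) y by apply: xyZ; right.
  exists y; first exact: monoZ (leq0n _) _ Zy.
  split => //; rewrite /prec; have := lev_ge _ _ Zy.
  by rewrite leq_eqVlt => /orP[/eqP|]; [right|left].
have prec_trans x y z : prec x y -> prec y z -> prec x z.
  move=> [xy|[xy dxy]] [yz|[yz dyz]].
  - by left; exact: ltn_trans yz.
  - by left; rewrite yz.
  - by left; rewrite -xy.
  - right; split; first by rewrite yz.
    by apply: leq_trans dxy; rewrite xy in dyz; exact: leqW.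
have s_prec i j : (i < j)%N -> prec (s i) (s j).
  elim: j => // j IH; rewrite ltnS leq_eqVlt => /orP[/eqP ->|/IH ij].
    by have [_ []] := sP j.
  by apply: prec_trans ij _; have [_ []] := sP j.
have precxx x : ~ prec x x by move=> [|[_]]; rewrite ltnn.
have lev_mono i j : (i <= j)%N -> (lev (s i) <= lev (s j))%N.
  rewrite leq_eqVlt => /orP[/eqP -> //|/s_prec[/ltnW//|[-> _//]]].
have lev_up k i : (d (lev (s i)) (s i) <= k)%N -> exists j, (lev (s i) < lev (s j))%N.
  elim: k i => [|k IH] i di; have [_ [_ [lt|[e lt]]]] := sP i; try by exists i.+1.
    by move: lt; rewrite ltnNge (leq_trans di).
  have [|j] := IH i.+1; first by rewrite e -ltnS; exact: leq_trans di.
  by rewrite e => ?; exists j.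
exists s; first split.
- by move=> i; apply: ZV; have [] := sP i.
- move=> i j sij; case: (ltngtP i j) => // /s_prec; rewrite sij => /precxx //.
- by move=> i; have [_ []] := sP i.
move=> n; suff [N levN] : exists N, (n <= lev (s N))%N.
  exists N => i Ni; apply: (monoZ _ (lev (s i))).
    exact: leq_trans levN (lev_mono _ _ Ni).
  by have [/levP[]] := sP i.
elim: n => [|n [N nN]]; first by exists 0%N.
by have [j lt] := lev_up _ N (leqnn _); exists j; exact: leq_ltn_trans lt.
Qed.

End Graph_walks.

(** * Edge-ends through representing rays *)

Section Ends.
Context {U : Type} (G : graph U).
Implicit Types (A B C K : set U) (F H : set (set U)) (x y v : U) (r s : nat -> U).
Implicit Types (eps eta : edge_end G).

Definition eventually_in C r := exists N, forall n, (N <= n)%N -> C (r n).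

Definition ray_near F r s := exists N, forall m n, (N <= m)%N -> (N <= n)%N ->
  link G setT F (r m) (s n).

Lemma ray_tail_linked C F r : is_ray G r -> finite_set F -> eventually_in C r ->
  exists N, forall n, (N <= n)%N -> C (r n) /\ link G C F (r N) (r n).
Proof.
move=> Gr finF [M CM]; have [N [_ _ rN]] := ray_del_tail Gr finF.
exists (maxn M N) => n; elim: n => [|n IH].
  rewrite leqn0 => /eqP E; rewrite E; split; last exact: link_refl.
  by apply: CM; rewrite -E leq_maxl.
rewrite leq_eqVlt => /orP[/eqP <-|].
  by split; [apply: CM; rewrite leq_maxl|exact: link_refl].
rewrite ltnS => MNn; have [Cn ln] := IH MNn; move: MNn; rewrite geq_max => /andP[Mn Nn].
have Cn1 : C (r n.+1) by apply: CM; exact: leqW.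
split => //; apply: link_trans ln _.
have := rN (n - N)%N; rewrite /tail addnS subnKC // => -[Gn nF].
exact: link_edge.
Qed.

Lemma ray_near_refl F r : is_ray G r -> finite_set F -> ray_near F r r.
Proof.
move=> Gr finF.
have [|N NP] := @ray_tail_linked setT F r Gr finF; first by exists 0%N.
exists N => m n /NP[_ h] /NP[_ h']; exact: link_trans (link_sym h) h'.
Qed.

Lemma ray_near_sym F r s : ray_near F r s -> ray_near F s r.
Proof. by move=> [N h]; exists N => m n Nm Nn; exact/link_sym/h. Qed.

Lemma ray_near_trans F r s t : ray_near F r s -> ray_near F s t -> ray_near F r t.
Proof.
move=> [N h] [M k]; exists (maxn N M) => m n; rewrite !geq_max.
move=> /andP[Nm Mm] /andP[Nn Mn].
by apply: link_trans (h m (maxn N M) Nm _) (k _ n _ Mn); rewrite ?leq_maxl ?leq_maxr.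
Qed.

Lemma del_edges_link F x y : walk (del_edges G F) x y <-> link G setT F x y.
Proof.
split; apply: walk_sub.
  by split=> [z Vz|e [Ge nF]]; split.
by split=> [z []//|e [Ge nF _]]; split.
Qed.

Lemma component_link (C : graph U) F x y : component C (del_edges G F) ->
  vertices C x -> vertices C y -> link G setT F x y.
Proof.
move=> [CG [_ cC] _] Cx Cy; apply/del_edges_link; exact: walk_sub CG (cC _ _ Cx Cy).
Qed.

Lemma link_component (C : graph U) F x y : component C (del_edges G F) ->
  vertices C x -> link G setT F x y -> vertices C y.
Proof.
move=> hC Cx xy; rewrite (componentE hC Cx); split; last exact/del_edges_link.
by apply: link_vertex xy; have [[+ _] _ _] := hC; apply.
Qed.

(** Two rays are edge-equivalent if and only if late vertices of both can always
    be linked; from here on, components are replaced by walks. *)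
Lemma edge_equiv_near r s : is_ray G r -> is_ray G s ->
  edge_equiv G r s <-> forall F, finite_cut G F -> ray_near F r s.
Proof.
move=> Gr Gs; split=> [rs F [finF FG]|rs F finF FG].
  have [C [hC [n [rC _ _]] [m [sC _ _]]]] := rs F finF FG.
  exists (maxn n m) => i j; rewrite !geq_max => /andP[ni _] /andP[_ mj].
  apply: (component_link hC).
    by have := rC (i - n)%N; rewrite /tail subnKC.
  by have := sC (j - m)%N; rewrite /tail subnKC.
have [C [hC [n rC]]] := ray_component Gr finF.
have [C' [hC' [m sC']]] := ray_component Gs finF.
exists C; split; [by []|by exists n|exists m].
suff -> : C = C' by [].
have [N rsN] := rs F (conj finF FG).
have [rCV _ _] := rC; have [sCV _ _] := sC'.
apply: (component_uniq (x := s (maxn m N)) hC hC'); last first.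
  by have := sCV (maxn m N - m)%N; rewrite /tail subnKC // leq_maxl.
apply: (link_component (x := r (maxn n N)) hC).
  by have := rCV (maxn n N - n)%N; rewrite /tail subnKC // leq_maxl.
by apply: rsN; exact: leq_maxr.
Qed.

Definition rep eps : nat -> U := projT1 (cid2 (edge_endP eps)).

Lemma rep_ray eps : is_ray G (rep eps).
Proof. by rewrite /rep; case: cid2. Qed.

Lemma end_raysE eps : end_rays eps =
  [set s | is_ray G s /\ edge_equiv G (rep eps) s].
Proof. by rewrite /rep; case: cid2. Qed.

Definition near F eps eta := ray_near F (rep eps) (rep eta).

Lemma near_refl F eps : finite_set F -> near F eps eps.
Proof. exact/ray_near_refl/rep_ray. Qed.

Lemma end_eq eps eta : (forall F, finite_cut G F -> near F eps eta) -> eps = eta.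
Proof.
move=> /(edge_equiv_near (rep_ray eps) (rep_ray eta)) ee.
have : end_rays eps = end_rays eta.
  rewrite !end_raysE; apply/seteqP; split=> s [Gs es]; split => //.
    exact: edge_equiv_trans (edge_equiv_sym ee) es.
  exact: edge_equiv_trans ee es.
case: eps eta {ee} => [R RP] [S SP] /= RS; subst S; congr EdgeEnd.
exact: Prop_irrelevance.
Qed.

Lemma end_of_ray r : is_ray G r ->
  exists eps, forall F, finite_cut G F -> ray_near F (rep eps) r.
Proof.
move=> Gr; exists (EdgeEnd (ex_intro2 _ _ r Gr erefl)).
set eps := EdgeEnd _.
have : end_rays eps r by split => //; exact: edge_equiv_refl.
by rewrite end_raysE => -[_] /(edge_equiv_near (rep_ray eps) Gr).
Qed.

Lemma end_nbhd_near F eps eta : finite_cut G F ->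
  end_nbhd eps F eta <-> near F eps eta.
Proof.
move=> cF; have [finF FG] := cF; split=> [[C [hC epsC] [r]]|en].
  rewrite end_raysE => -[Gr] /(edge_equiv_near (rep_ray eta) Gr) /(_ F cF) er.
  move=> [rC _ _]; apply: ray_near_trans (ray_near_sym er).
  have [|n [eC _ _]] := epsC (rep eps).
    by rewrite end_raysE; split; [exact: rep_ray|exact/edge_equiv_refl/rep_ray].
  exists n => i j ni _; apply: (component_link hC); last exact: rC.
  by have := eC (i - n)%N; rewrite /tail subnKC.
have [C hC] := end_component_ex eps finF FG; exists C => //.
have [hC1 epsC] := hC.
have [|n [eC _ _]] := epsC (rep eps).
  by rewrite end_raysE; split; [exact: rep_ray|exact/edge_equiv_refl/rep_ray].
have [C' [hC' [m sC']]] := ray_component (rep_ray eta) finF.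
have [sCV _ _] := sC'; have [N enN] := en.
have E : C = C'.
  apply: (component_uniq (x := rep eta (maxn m N)) hC1 hC'); last first.
    by have := sCV (maxn m N - m)%N; rewrite /tail subnKC // leq_maxl.
  apply: (link_component (x := rep eps (maxn n N)) hC1).
    by have := eC (maxn n N - n)%N; rewrite /tail subnKC // leq_maxl.
  by apply: enN; exact: leq_maxr.
subst C'; exists (tail m (rep eta)) => //.
have mray := is_ray_tail m (rep_ray eta).
rewrite end_raysE; split => //; apply/(edge_equiv_near (rep_ray eta) mray).
move=> F' [finF' _]; have [M h] := ray_near_refl (rep_ray eta) finF'.
by exists M => i j Mi Mj; apply: h => //; exact: leq_trans (leq_addl _ _).
Qed.

Lemma open_near (A : set (edge_end G)) : open A <->
  forall eps, A eps -> exists2 F, finite_cut G F & forall eta, near F eps eta -> A eta.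
Proof.
rewrite -[open A]/(end_open A); split=> oA eps /oA; last first.
  move=> [F [finF FG] FA]; exists F; split => // eta.
  by move/(end_nbhd_near _ _ (conj finF FG)); exact: FA.
move=> [F [finF FG FA]]; exists F => // eta en; apply: FA.
exact/end_nbhd_near.
Qed.

Definition ends_in C := [set eps | eventually_in C (rep eps)].

(** Rays that stay close across the boundary of C are on the same side of it, so
    membership in [ends_in C] is decided by the finite set [boundary C]. *)
Lemma eventually_in_near C r s : finite_set (boundary G C) ->
  ray_near (boundary G C) r s -> eventually_in C r -> eventually_in C s.
Proof.
move=> fC [N rs] [M rC]; exists N => n Nn.
apply: link_stay (rs (maxn M N) n _ Nn) _ => //; first exact: leq_maxr.
by apply: rC; exact: leq_maxl.
Qed.

Lemma ends_in_clopen C : finite_set (boundary G C) -> clopen (ends_in C).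
Proof.
move=> fC; have cC := boundary_cut fC; split.
  apply/open_near => eps epsC; exists (boundary G C) => // eta en.
  exact: eventually_in_near en epsC.
rewrite -openC; apply/open_near => eps epsC; exists (boundary G C) => // eta en etaC.
by apply: epsC; apply: eventually_in_near (ray_near_sym en) etaC.
Qed.

Lemma edge_end_accessible : accessible_space (edge_end G).
Proof.
move=> eps eta /eqP ne.
have [F [cF nn]] : exists F, finite_cut G F /\ ~ near F eps eta.
  apply: contrapT => no; apply: ne; apply: end_eq => F cF.
  by apply: contrapT => nn; apply: no; exists F.
exists [set zeta | near F eps zeta]; split; rewrite ?inE //.
  apply/open_near => zeta ez; exists F => // xi; exact: ray_near_trans ez.
by apply: near_refl; have [] := cF.
Qed.

End Ends.

(** * Splitting a connected set at a vertex *)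

Section Splitting.
Context {U : Type} (G : graph U).
Implicit Types (A B C K Z : set U) (F H : set (set U)) (x y : U).
Variable v : U.

Definition vertex_class : set U :=
  [set x | forall F, finite_cut G F -> link G setT F x v].

Definition dominates (eps : edge_end G) := forall F, finite_cut G F ->
  exists N, forall n, (N <= n)%N -> link G setT F v (rep eps n).

Lemma vertex_class_refl : vertex_class v.
Proof. by move=> F _; exact: link_refl. Qed.

Definition attachment K F x := [set e | edges G e /\
  exists a b, [/\ comp G K F x a, vertex_class b & e = [set a; b]]].

(** The component of x in K without F is called attached if it sends infinitely
    many edges to the class of v.  Such a component cannot be separated from v by
    finitely many edges unless these also cut through the component. *)
Definition attached K F x := infinite_set (attachment K F x).

Lemma attached_sub K F F' x : F `<=` F' -> attached K F' x -> attached K F x.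
Proof.
move=> FF'; apply: sub_infinite_set => e [Ge [a [b [xa bv E]]]]; split => //.
by exists a, b; split => //; exact: link_sub xa.
Qed.

Lemma attached_eq K F x y : link G K F x y -> attached K F x -> attached K F y.
Proof. by move=> xy; rewrite /attached /attachment (comp_eq xy). Qed.

Lemma attached_link K F H x : finite_cut G H ->
  (forall a, comp G K F x a -> link G setT H x a) -> attached K F x ->
  link G setT H x v.
Proof.
move=> cH xH att.
have /infinite_setN0[e [[Ge [a [b [xa bv E]]]] nHe]] := infinite_setD att cH.1.
rewrite E in Ge nHe.
apply: link_trans (xH a xa) _; apply: link_trans (bv H cH).
exact: link_edge.
Qed.

Variable cut : U -> set (set U).
Hypothesis cut_finite : forall x, finite_cut G (cut x).
Hypothesis cutP : forall x, ~ vertex_class x -> ~ link G setT (cut x) x v.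
Variable base : set U -> U.
Hypothesis baseP : forall K, K !=set0 -> K (base K).

(** For a set K of vertices disjoint from the class of v, deleting the edges of
    [stage K n] leaves components of K; the next stage separates from v the base
    point of K and those endpoints of the edges deleted so far that are outside
    the class of v.  So these vertices are not in attached components of the
    next stage, and the attached components shrink to the empty set. *)
Fixpoint stage K n : set (set U) :=
  if n is m.+1 then
    stage K m `|` \bigcup_(x in (endpoints (stage K m) `|` [set base K])) cut x
  else set0.

Lemma stage_finite K n : finite_cut G (stage K n).
Proof.
elim: n => [|n IH]; first by split=> [|e []]; exact: finite_set0.
apply: finite_cutU => //; apply: finite_cut_bigcup cut_finite.
by rewrite finite_setU; split; [exact: finite_endpoints IH|exact: finite_set1].
Qed.

Lemma stage_sub K m n : (m <= n)%N -> stage K m `<=` stage K n.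
Proof.
elim: n => [|n IH]; first by rewrite leqn0 => /eqP ->.
rewrite leq_eqVlt => /orP[/eqP -> //|/IH h]; apply: subset_trans h _.
exact: subsetUl.
Qed.

Lemma stage_detached K n x : ~ vertex_class x ->
  (endpoints (stage K n) `|` [set base K]) x -> ~ attached K (stage K n.+1) x.
Proof.
move=> nx xn /(attached_link (cut_finite x)) h; apply: (cutP nx); apply: h => a.
by apply: link_sub => // e xe; right; exists x.
Qed.

(** Walk from the base point of K to x.  Each step raises the required stage by at
    most one: an edge not deleted so far stays inside one component, and the
    endpoints of a deleted edge are separated from v at the next stage. *)
Lemma stage_exhausts K x : connected_set G K -> (forall y, K y -> ~ vertex_class y) ->
  K x -> exists n, ~ attached K (stage K n) x.
Proof.
move=> cK Kv Kx.
have Kb : K (base K) by apply: baseP; exists x.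
apply: (walk_invariant (P := fun x => exists n, ~ attached K (stage K n) x) _ _
  (cK _ _ Kb Kx)).
  by exists 1%N; apply: stage_detached; [exact: Kv|right].
move=> a b [n na] [Gab _ abK]; exists n.+1 => nb.
have Ka : K a by apply: abK; left.
have Kbb : K b by apply: abK; right.
have [Fab|nFab] := pselect (stage K n [set a; b]).
  apply: stage_detached nb; first exact: Kv.
  by left; exists [set a; b] => //; right.
apply: na; apply: attached_eq (attached_sub (@stage_sub K n n.+1 _) nb) => //.
by apply/link_sym/link_edge.
Qed.

Lemma stage_exhausts_finite K S : connected_set G K ->
  (forall y, K y -> ~ vertex_class y) -> finite_set S ->
  exists n, forall x, S x -> K x -> ~ attached K (stage K n) x.
Proof.
move=> cK Kv finS.
apply: (@finite_uniform_bound _ S (fun x n => K x -> ~ attached K (stage K n) x)) => //.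
  move=> x _; have [Kx|nKx] := pselect (K x); last by exists 0%N.
  by have [n] := stage_exhausts cK Kv Kx; exists n.
move=> x m n mn h /h nm Kx; apply: nm; exact: attached_sub (stage_sub mn) Kx.
Qed.

Definition first_detached K n x := ~ attached K (stage K n) x /\
  forall m, (m < n)%N -> attached K (stage K m) x.

(** The component of x at the first stage at which it is not attached. *)
Definition piece K x := [set y | exists n, first_detached K n x /\
  comp G K (stage K n) x y].

Lemma first_detached_ex K x n : ~ attached K (stage K n) x ->
  exists2 m, (m <= n)%N & first_detached K m x.
Proof.
move=> nx; have ex : exists n, `[< ~ attached K (stage K n) x >].
  by exists n; exact/asboolP.
case: (ex_minnP ex) => m /asboolP nm minm; exists m.
  by apply: minm; exact/asboolP.
split => // i im; apply: contrapT => /asboolP /minm.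
by rewrite leqNgt im.
Qed.

Lemma pieceE K n x : first_detached K n x -> piece K x = comp G K (stage K n) x.
Proof.
move=> [nx mx]; apply/seteqP; split=> y; last by exists n.
move=> [m [[mx' nx'] xy]].
have [mn|nm|<- //] := ltngtP m n; first by have := mx _ mn.
by have := nx' _ nm.
Qed.

Lemma first_detached_eq K n x y : link G K (stage K n) x y ->
  first_detached K n x -> first_detached K n y.
Proof.
move=> xy [nx mx]; split.
  by move=> h; apply: nx; apply: attached_eq h; exact: link_sym.
move=> m mn; apply: attached_eq (mx m mn); apply: link_sub xy => //.
exact/stage_sub/ltnW.
Qed.

Variable C : set U.
Hypothesis CV : C `<=` vertices G.
Hypothesis Cconn : connected_set G C.
Hypothesis Cbd : finite_set (boundary G C).
Hypothesis Cv : C v.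

(** If v dominates an edge-end of C, a lobe may have infinite boundary, namely
    when it contains rays of this edge-end; this is why lobes are cut further
    into pieces. *)
Let lobe x := comp G (C `\` vertex_class) set0 x.
Let child x := piece (lobe x) x.

Let lobe_sub x : (C `\` vertex_class) x -> lobe x `<=` C `\` vertex_class.
Proof. by move=> Cx y; exact: link_in. Qed.

Let lobe_connected x : connected_set G (lobe x).
Proof. exact: comp_connected. Qed.

Let lobe_refl x : lobe x x.
Proof. exact: link_refl. Qed.

Let lobe_far x : (C `\` vertex_class) x -> forall y, lobe x y -> ~ vertex_class y.
Proof. by move=> Cx y /(lobe_sub Cx)[]. Qed.

Let childE x : (C `\` vertex_class) x -> exists n, first_detached (lobe x) n x /\
  child x = comp G (lobe x) (stage (lobe x) n) x.
Proof.
move=> Cx.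
have [n /first_detached_ex[m _ mx]] := 
  stage_exhausts (@lobe_connected x) (lobe_far Cx) (lobe_refl x).
by exists m; split => //; exact: pieceE.
Qed.

Let child_sub_lobe x : (C `\` vertex_class) x -> child x `<=` lobe x.
Proof. by move=> Cx; have [n [_ ->]] := childE Cx => y; exact: link_in. Qed.

Let child_eq x y : (C `\` vertex_class) x -> child x y -> child y = child x.
Proof.
move=> Cx xy; have lxy := child_sub_lobe Cx xy.
have [n [nx E]] := childE Cx.
have Exy : lobe x = lobe y := comp_eq lxy.
rewrite E in xy *; rewrite /child -Exy (pieceE (first_detached_eq xy nx)).
exact/esym/comp_eq.
Qed.

(** A boundary edge that is not deleted and does not leave C leads to the class of
    v, and there are finitely many of those because the piece is not attached. *)
Let child_boundary x : (C `\` vertex_class) x -> finite_set (boundary G (child x)).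
Proof.
move=> Cx; have [n [[nx _] ->]] := childE Cx.
set K := lobe x; set F := stage K n.
apply: (@sub_finite_set _ _ (F `|` boundary G C `|` attachment K F x)).
  move=> e [Ge [a [b [xa nxb E]]]].
  have [Fe|nFe] := pselect (F e); first by left; left.
  have Ka : K a := link_in (lobe_refl x) xa.
  have [Ca nav] := lobe_sub Cx Ka.
  have [Cb|nCb] := pselect (C b); last first.
    by left; right; split => //; exists a, b.
  have [bv|nbv] := pselect (vertex_class b); first by right; split => //; exists a, b.
  exfalso; apply: nxb; apply: link_trans xa _.
  rewrite E in Ge nFe; apply: link_edge => //.
  by apply: link_trans Ka _; apply: link_edge.
rewrite !finite_setU; split; last exact: contrapT.
by split => //; have [] := stage_finite K n.
Qed.

Definition children := [set child x | x in C `\` vertex_class].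

Lemma children_spec Z : children Z ->
  [/\ Z !=set0, connected_set G Z, Z `<=` C, ~ Z v & finite_set (boundary G Z)].
Proof.
move=> [x Cx <-]; have [n [_ E]] := childE Cx; split.
- by exists x; rewrite E; exact: link_refl.
- rewrite E; exact: comp_connected.
- by move=> y /(child_sub_lobe Cx) /(lobe_sub Cx)[].
- move=> /(child_sub_lobe Cx) /(lobe_sub Cx)[_]; apply; exact: vertex_class_refl.
- exact: child_boundary.
Qed.

Lemma children_disjoint Z Z' x : children Z -> children Z' -> Z x -> Z' x -> Z = Z'.
Proof. by move=> [y Cy <-] [z Cz <-] /(child_eq Cy) <- /(child_eq Cz) <-. Qed.

(** A ray not dominated by v eventually avoids the class of v, hence stays in one
    lobe.  If it stayed in attached components at all stages, then at a stage
    where the attached components avoid the endpoints of a given finite H it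
    would be linked to v outside H; so v would dominate it. *)
Lemma children_cover (eps : edge_end G) : ends_in C eps -> ~ dominates eps ->
  exists2 Z, children Z & ends_in Z eps.
Proof.
move=> [N0 epsC] ndom; set r := rep eps; have Gr : is_ray G r := rep_ray eps.
have [H [cH nH]] : exists H, finite_cut G H /\
    ~ exists N, forall n, (N <= n)%N -> link G setT H v (r n).
  apply: contrapT => no; apply: ndom => F cF; apply: contrapT => nF.
  by apply: no; exists F.
(* One visit to the class of v after N1 would link all late vertices to v. *)
have [|N1 N1P] := @ray_tail_linked _ G setT H r Gr cH.1; first by exists 0%N.
have far n : (N1 <= n)%N -> ~ link G setT H v (r n).
  move=> Nn vn; apply: nH; exists N1 => m /N1P[_ l]; apply: link_trans vn _.
  by apply: link_trans l; apply: link_sym; have [] := N1P n Nn.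
have [|N NP] := @ray_tail_linked _ G (C `\` vertex_class) set0 r Gr (finite_set0 _).
  exists (maxn N0 N1) => n; rewrite geq_max => /andP[N0n N1n]; split; first exact: epsC.
  by move=> rv; apply: far N1n _; exact/link_sym/(rv H cH).
pose x := r N; have Cx : (C `\` vertex_class) x by have [] := NP N (leqnn _).
pose K := lobe x.
have /choice[M MP] : forall m, exists M, forall n, (M <= n)%N ->
    K (r n) /\ link G K (stage K m) (r M) (r n).
  move=> m; apply: ray_tail_linked => //; first by have [] := stage_finite K m.
  by exists N => n /NP[].
have KM m : K (r (M m)) by have [] := MP m (M m) (leqnn _).
have [[m nm]|att] := pselect (exists m, ~ attached K (stage K m) (r (M m))).
  have [i im idet] := first_detached_ex nm.
  have CM : (C `\` vertex_class) (r (M m)) := lobe_sub Cx (KM m).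
  exists (child (r (M m))); first by exists (r (M m)).
  exists (M m) => n /MP[Kn ln]; rewrite /child.
  have <- : K = lobe (r (M m)) := comp_eq (KM m).
  by rewrite (pieceE idet); apply: link_sub ln => //; exact: stage_sub.
have [m mP] := stage_exhausts_finite (@lobe_connected x) (lobe_far Cx)
  (finite_endpoints cH).
have [|Kn ln] := MP m (maxn N1 (M m)); first exact: leq_maxr.
set y := r _ in Kn ln.
have am : attached K (stage K m) y.
  by apply: attached_eq ln _; apply: contrapT => nm; apply: att; exists m.
exfalso; apply: (far (maxn N1 (M m))); first exact: leq_maxl.
apply/link_sym; apply: (attached_link cH _ am) => a ya.
apply: link_sub (_ : link G (comp G K (stage K m) y) H y a) => //.
apply: connected_avoid ya; [exact: comp_connected| |exact: link_refl].
move=> z yz Hz; apply: (mP z Hz); first exact: link_in Kn yz.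
exact: attached_eq yz am.
Qed.

(** A lobe that avoids the endpoints of H is linked to v outside H by any of its
    edges to the class of v.  In each of the finitely many other lobes, the
    attached components at a late stage m avoid these endpoints, so the pieces
    inside them are linked to v as well; the remaining pieces of the lobe are
    among the finitely many components of the stages up to m. *)
Lemma children_cofinite H : finite_cut G H ->
  finite_set [set Z | children Z /\ ~ forall z, Z z -> link G setT H z v].
Proof.
move=> cH.
have /choice[m mP] : forall h, exists m, (C `\` vertex_class) h ->
    forall x, endpoints H x -> lobe h x ->
      ~ attached (lobe h) (stage (lobe h) m) x.
  move=> h; have [Ch|] := pselect ((C `\` vertex_class) h); last by exists 0%N.
  have [m mP] := stage_exhausts_finite (@lobe_connected h) (lobe_far Ch)
    (finite_endpoints cH).
  by exists m.
apply: (@sub_finite_set _ _ (\bigcup_(h in endpoints H) \bigcup_(n in `I_(m h).+1)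
    [set comp G (lobe h) (stage (lobe h) n) x | x in lobe h])); last first.
  apply: bigcup_finite; first exact: finite_endpoints cH.
  move=> h _; apply: bigcup_finite; first exact: finite_II.
  move=> n _; apply: (@finite_comps _ _ _ _ h) => //; exact: stage_finite.
move=> _ [[x Cx <-] far].
have [n [idet E]] := childE Cx.
have [[h [Hh xh]]|no] := pselect (exists h, endpoints H h /\ lobe x h); last first.
  (* C is connected and contains v, so some edge leaves the lobe inside C. *)
  have [a [b [xa bv Cb Gab]]] : exists a b,
      [/\ lobe x a, vertex_class b, C b & edges G [set a; b]].
    apply: contrapT => noedge; apply: (lobe_far Cx (y := v)); last first.
      exact: vertex_class_refl.
    apply: (walk_invariant (P := lobe x) (@lobe_refl x) _ (Cconn Cx.1 Cv)).
    move=> a b xa [Gab _ abC]; have Cb : C b by apply: abC; right.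
    have [bv|nbv] := pselect (vertex_class b).
      by exfalso; apply: noedge; exists a, b.
    apply: (link_trans xa); apply: link_edge => //.
    exact: lobe_sub Cx _ xa.
  exfalso; apply: far => z xz; have lz := child_sub_lobe Cx xz.
  apply: link_trans (bv H cH); apply: (@link_trans _ _ _ _ _ a).
    apply: link_sub (_ : link G (lobe x) H z a) => //.
    by apply: connected_avoid => // y xy Hy; apply: no; exists y.
  by apply: link_edge => // Hab; apply: no; exists a; split => //; exists [set a; b] => //; left.
have Exh : lobe x = lobe h := comp_eq xh.
have Ch : (C `\` vertex_class) h := lobe_sub Cx xh.
exists h => //; exists n; last first.
  by exists x; rewrite -Exh ?E //; exact: lobe_refl.
rewrite /= ltnS leqNgt; apply/negP => mn; apply: far => z; rewrite E => xz.
have {}xz : link G (lobe x) (stage (lobe x) (m h)) x z.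
  by apply: link_sub xz => //; exact/stage_sub/ltnW.
have am : attached (lobe x) (stage (lobe x) (m h)) z.
  by apply: attached_eq xz _; have [_] := idet; apply.
apply: (attached_link cH _ am) => a za.
apply: link_sub (_ : link G (comp G (lobe x) (stage (lobe x) (m h)) z) H z a) => //.
apply: connected_avoid za; [exact: comp_connected| |exact: link_refl].
move=> y zy Hy; have ly : lobe x y := link_in (link_in (@lobe_refl x) xz) zy.
rewrite Exh in ly am zy; apply: (mP h Ch y Hy ly); exact: attached_eq zy am.
Qed.
End Splitting.

(** * The tree of regions *)

Section Regions.
Context {U : Type} (G : graph U).

Record region := Region {
  rset : set U;
  region_sub : rset `<=` vertices G;
  region_nonempty : rset !=set0;
  region_connected : connected_set G rset;
  region_boundary : finite_set (boundary G rset) }.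

Implicit Types (C D : region) (F : set (set U)) (eps eta : edge_end G).

Lemma region_eq C D : rset C = rset D -> C = D.
Proof.
case: C D => [C c1 c2 c3 c4] [D d1 d2 d3 d4] /= CD; subst D.
by congr Region; exact: Prop_irrelevance.
Qed.

Lemma region_split C v : rset C v -> exists Zs : set region,
  [/\ forall D, Zs D -> rset D `<=` rset C /\ ~ rset D v,
      forall D D' x, Zs D -> Zs D' -> rset D x -> rset D' x -> D = D',
      forall eps, ends_in (rset C) eps -> ~ dominates v eps ->
        exists2 D, Zs D & ends_in (rset D) eps &
      forall F, finite_cut G F ->
        finite_set [set D | Zs D /\ ~ forall z, rset D z -> link G setT F z v]].
Proof.
move=> Cv.
have /choice[cut cutP] : forall x, exists F, finite_cut G F /\
    (~ vertex_class G v x -> ~ link G setT F x v).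
  move=> x; have [vx|nvx] := pselect (vertex_class G v x).
    by exists set0; split=> //; split=> [|e []]; exact: finite_set0.
  apply: contrapT => no; apply: nvx => F cF; apply: contrapT => nl; apply: no.
  by exists F.
have cut_fin x := (cutP x).1; have cut_far x := (cutP x).2.
have /choice[base baseP] : forall K : set U, exists x, K !=set0 -> K x.
  move=> K; have [[x Kx]|nK] := pselect (K !=set0); first by exists x.
  by exists v.
pose chl := children G v cut base (rset C).
have [CV cC bC] := And3 (@region_sub C) (@region_connected C) (region_boundary C).
have chlP := children_spec cut_fin cut_far baseP bC.
have reg Z : chl Z -> exists D, rset D = Z.
  move=> /chlP[Z0 cZ ZC _ bZ].
  by exists (Region (subset_trans ZC CV) Z0 cZ bZ).
exists [set D | chl (rset D)]; split.
- by move=> D /chlP[].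
- move=> D D' x cD cD' Dx D'x; apply: region_eq.
  exact: (children_disjoint cut_fin cut_far baseP cD cD' Dx D'x).
- move=> eps Ceps ndom.
  have [Z cZ Zeps] := children_cover cut_fin cut_far baseP Ceps ndom.
  by have [D DZ] := reg Z cZ; exists D; rewrite /= DZ.
- move=> F cF.
  have := children_cofinite cut_fin cut_far baseP cC Cv cF.
  by apply: (finite_preimage (f := rset)) => D D' _ _; exact: region_eq.
Qed.

(** The height is the distance to a root chosen in each component of G.  A vertex
    of least height in C that is not a root has a neighbour of smaller height, so
    it is an endpoint of a boundary edge of C; and C contains at most one root. *)
Lemma height_function : exists h : U -> nat, forall C,
  finite_set [set x | rset C x /\ forall y, rset C y -> (h x <= h y)%N].
Proof.
have /choice[root rootP] : forall S : {S : set U | S !=set0}, exists x, sval S x.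
  by move=> [S [x Sx]]; exists x.
pose class x := comp G setT set0 x.
have class0 x : class x !=set0 by exists x; exact: link_refl.
pose rt x := root (exist _ (class x) (class0 x)).
have rt_link x : link G setT set0 x (rt x) by exact: (rootP (exist _ _ (class0 x))).
have rt_eq x y : link G setT set0 x y -> rt x = rt y.
  move=> lxy; have xy := comp_eq lxy; rewrite /rt; congr root; exact: eq_exist.
have [h hP] := distance_function (within G setT set0) (range rt).
exists h => C.
apply: (@sub_finite_set _ _ (endpoints (boundary G (rset C)) `|`
    [set x | rset C x /\ range rt x])).
  move=> x [Cx minx].
  have [|xrt|[y [[Gxy _ _] hyx _]]] := hP x.
  - by exists (rt x); [exists x|exact: rt_link].
  - by right.
  left; exists [set x; y]; last by left.
  split => //; exists x, y; split => // Cy.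
  by have := minx y Cy; rewrite leqNgt hyx.
rewrite finite_setU; split.
  exact/finite_endpoints/boundary_cut/region_boundary.
have [[x [Cx [z _ xz]]]|no] := pselect (exists x, rset C x /\ range rt x); last first.
  by apply: sub_finite_set (finite_set0 U) => x xC; apply: no; exists x.
apply: sub_finite_set (finite_set1 x) => y [Cy [w _ yw]] /=.
have rxx u : rt (rt u) = rt u by apply/esym/rt_eq.
rewrite -xz -yw -(rxx z) -(rxx w) xz yw; apply: rt_eq.
by apply: link_sub (region_connected Cy Cx).
Qed.

(** The pivot is a vertex of least height.  While the least height along a
    decreasing sequence of regions stays d, the pivots are distinct vertices of
    height d in one region, of which there are finitely many; so the least height
    is unbounded. *)
Lemma pivot_function : exists pivot : region -> U,
  (forall C, rset C (pivot C)) /\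
  forall s : nat -> region,
    (forall n, rset (s n.+1) `<=` rset (s n) /\ ~ rset (s n.+1) (pivot (s n))) ->
    forall x, exists n, ~ rset (s n) x.
Proof.
have [h hP] := height_function.
have /choice[pivot pP] : forall C, exists x, rset C x /\
    forall y, rset C y -> (h x <= h y)%N.
  move=> C; have ex : exists n, `[< exists2 x, rset C x & h x = n >].
    by have [x Cx] := region_nonempty C; exists (h x); apply/asboolP; exists x.
  case: (ex_minnP ex) => n /asboolP[x Cx <-] minn; exists x; split => // y Cy.
  by apply: minn; apply/asboolP; exists y.
exists pivot; split=> [C|s sP x]; first by have [] := pP C.
have mono m n : (m <= n)%N -> rset (s n) `<=` rset (s m).
  elim: n => [|n IH]; first by rewrite leqn0 => /eqP ->.
  rewrite leq_eqVlt => /orP[/eqP -> //|/IH]; apply: subset_trans.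
  by have [] := sP n.
suff [n nP] : exists n, forall y, rset (s n) y -> ((h x).+1 <= h y)%N.
  by exists n => /nP; rewrite ltnn.
elim: (h x).+1 => [|d [n nP]]; first by exists 0%N.
apply: contrapT => no.
have hd k : h (pivot (s (n + k)%N)) = d.
  have [pk mink] := pP (s (n + k)%N); apply/eqP; rewrite eqn_leq.
  rewrite (nP _ (mono _ _ (leq_addr k n) _ pk)) andbT leqNgt; apply/negP => lt.
  by apply: no; exists (n + k)%N => y /mink; exact: leq_trans.
have pinj : injective (fun k => pivot (s (n + k)%N)).
  have lt i j : (i < j)%N -> pivot (s (n + i)%N) <> pivot (s (n + j)%N).
    move=> ij e; have [_] := sP (n + i)%N; apply; rewrite e.
    by apply: mono (pP _).1; rewrite -addnS leq_add2l.
  by move=> i j e; case: (ltngtP i j) => // /lt; rewrite e.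
apply: infinite_nat.
have -> : [set: nat] = (fun k => pivot (s (n + k)%N)) @^-1`
    [set x | rset (s n) x /\ forall y, rset (s n) y -> (h x <= h y)%N].
  apply/seteqP; split => // k _; split=> [|y /nP]; last by rewrite hd.
  by apply: mono (pP _).1; exact: leq_addr.
by apply: finite_preimage (hP _) => i j _ _; exact: pinj.
Qed.
(** The regions carry a ray, and a finite set of edges has no endpoint in late
    regions, which therefore lie in a single component of its complement. *)
Lemma region_limit (s : nat -> region) :
  (forall n, rset (s n.+1) `<=` rset (s n)) ->
  (forall x, exists n, ~ rset (s n) x) ->
  exists eps, forall n, ends_in (rset (s n)) eps /\
    forall V, open V -> V eps -> exists n, ends_in (rset (s n)) `<=` V.
Proof.
move=> decs caps.
have mono m n : (m <= n)%N -> rset (s n) `<=` rset (s m).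
  elim: n => [|n IH]; first by rewrite leqn0 => /eqP ->.
  by rewrite leq_eqVlt => /orP[/eqP -> //|/IH]; apply: subset_trans.
have [r Gr rs] : exists2 r, is_ray G r & forall n, eventually_in (rset (s n)) r.
  apply: (nested_ray (Z := fun n => rset (s n))) => // [n|n|].
  - exact: region_nonempty.
  - exact: region_connected.
  - exact: region_sub.
have [eps epsr] := end_of_ray Gr.
have eps_in n : ends_in (rset (s n)) eps.
  have bn := region_boundary (s n).
  exact: eventually_in_near bn (ray_near_sym (epsr _ (boundary_cut bn))) (rs n).
exists eps => n; split=> // V /open_near oV /oV[F cF FV].
have [m mP] : exists m, forall x, endpoints F x -> ~ rset (s m) x.
  apply: (finite_uniform_bound (P := fun x n => ~ rset (s n) x)).
  - exact: finite_endpoints cF.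
  - by move=> x _; exact: caps.
  - by move=> x i j ij nx /(mono _ _ ij).
exists m => eta [N etaN]; apply: FV; have [M epsM] := eps_in m.
exists (maxn N M) => i j; rewrite !geq_max => /andP[_ Mi] /andP[Nj _].
apply: link_sub (_ : link G (rset (s m)) F _ _) => //.
apply: connected_avoid; first exact: region_connected.
- by move=> z sz /mP.
- exact: epsM.
- exact: etaN.
Qed.

Lemma region_of_end eps : exists C, (exists2 x, vertices G x &
  rset C = comp G setT set0 x) /\ ends_in (rset C) eps.
Proof.
pose x := rep eps 0%N; have [Vr _ Er] := rep_ray eps.
have bd0 : boundary G (comp G setT set0 x) = set0.
  apply/seteqP; split => // e [Ge [a [b [xa xb E]]]]; apply: xb.
  by rewrite E in Ge; apply: (link_trans xa); exact: link_edge.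
have fin : finite_set (boundary G (comp G setT set0 x)) by rewrite bd0; exact: finite_set0.
have sub : comp G setT set0 x `<=` vertices G by move=> y; exact: (link_vertex (Vr 0)).
have ne : comp G setT set0 x !=set0 by exists x; exact: link_refl.
exists (Region sub ne (@comp_connected U G setT set0 x) fin); split; first by exists x => //; exact: Vr.
exists 0%N; elim=> [_|n IH _]; first exact: link_refl.
by apply: link_trans (IH isT) _; exact: link_edge.
Qed.

(** [None] is the root, which has the components of G as children. *)
Lemma edge_end_tree : inhabited (partition_tree (edge_end G)).
Proof.
have [pivot [pivot_in pivot_lim]] := pivot_function.
have /choice[Zs ZsP] := fun C => region_split (pivot_in C).
pose child (c k : option region) : Prop := match c, k with
  | _, None => False
  | None, Some D => exists2 x, vertices G x & rset D = comp G setT set0 x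
  | Some C, Some D => Zs C D
  end.
pose part (c : option region) : set (edge_end G) :=
  if c is Some C then ends_in (rset C) else setT.
pose mark (c : option region) : set (edge_end G) :=
  if c is Some C then dominates (pivot C) else set0.
have dom_in C : @dominates U G (pivot C) `<=` ends_in (rset C).
  move=> eps dom; have bC := region_boundary C.
  have [N NP] := dom _ (boundary_cut bC); exists N => n /NP l.
  exact: link_stay l (pivot_in C).
have meet C D eps : ends_in (rset C) eps -> ends_in (rset D) eps ->
    exists2 x, rset C x & rset D x.
  move=> [N CN] [M DM]; exists (rep eps (maxn N M)).
    by apply: CN; exact: leq_maxl.
  by apply: DM; exact: leq_maxr.
apply: inhabits; apply: (@PartitionTree _ (option region) None child part mark).
- by [].
- by move=> [C|]; [exact/ends_in_clopen/region_boundary|exact: clopenT].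
- move=> [C|] /=; last first.
    rewrite set0U; apply/seteqP; split => // eps _.
    by have [C [CG epsC]] := region_of_end eps; exists (Some C).
  have [Zsub Zdisj Zcov Zfin] := ZsP C.
  apply/seteqP; split=> eps.
    move=> Ceps; have [|ndom] := pselect (dominates (pivot C) eps); first by left.
    by right; have [D ZD Deps] := Zcov eps Ceps ndom; exists (Some D).
  move=> [/dom_in //|[[D|//] /= ZD [N DN]]]; exists N => n /DN.
  exact: (Zsub D ZD).1.
- move=> [C|] [k|] [l|] eps //= ck cl keps leps; congr Some;
    have [x kx lx] := meet _ _ _ keps leps.
    by have [_ Zdisj _ _] := ZsP C; exact: Zdisj ck cl kx lx.
  have [[y _ ky] [z _ lz]] := conj ck cl; rewrite ky in kx; rewrite lz in lx.
  by apply: region_eq; rewrite ky lz (comp_eq kx) (comp_eq lx).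
- move=> [C|//] [D|//] eps /= ZD dom Deps; have [Zsub _ _ _] := ZsP C.
  have bD := region_boundary D; have [N NP] := dom _ (boundary_cut bD).
  have [M MP] := Deps; apply: (Zsub D ZD).2.
  have l := link_sym (NP (maxn N M) (leq_maxl _ _)).
  by apply: link_stay l _ => //; apply: MP; exact: leq_maxr.
- move=> [C|//] eps eta /= de dt; apply: end_eq => F cF.
  have [N NP] := de F cF; have [M MP] := dt F cF.
  exists (maxn N M) => i j; rewrite !geq_max => /andP[Ni _] /andP[_ Mj].
  exact: link_trans (link_sym (NP i Ni)) (MP j Mj).
- move=> [C|//] eps V /= dom /open_near oV /oV[F cF FV].
  have [_ _ _ /(_ F cF) Zfin] := ZsP C.
  apply: sub_finite_set (finite_image Some Zfin) => -[D|] [/= ZD nDV] //.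
  exists D => //; split => // DF; apply: nDV => eta [M DM]; apply: FV.
  have [N NP] := dom F cF; exists (maxn N M) => i j.
  rewrite !geq_max => /andP[Ni _] /andP[_ Mj].
  exact: link_trans (link_sym (NP i Ni)) (link_sym (DF _ (DM j Mj))).
move=> s sP.
have below_region c d : below child c d -> exists D, d = Some D /\
    forall C, c = Some C -> rset D `<=` rset C /\ ~ rset D (pivot C).
  elim=> {c d} [c [D|]|c [D|] d ck _ [D' [-> DD']]]; try by case: c.
  - move=> cD; exists D; split => // C E; rewrite E in cD.
    by have [Zsub _ _ _] := ZsP C; exact: Zsub.
  - exists D'; split => // C E; rewrite E in ck.
    have [Zsub _ _ _] := ZsP C; have [DC nDp] := Zsub D ck.
    have [D'D _] := DD' D erefl; split; first exact: subset_trans DC.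
    by move=> /D'D.
  - by case: c ck.
have /choice[t tP] : forall n, exists D, s n.+1 = Some D.
  by move=> n; have [D [-> _]] := below_region _ _ (sP n); exists D.
have tdec n : rset (t n.+1) `<=` rset (t n) /\ ~ rset (t n.+1) (pivot (t n)).
  have [D [E /(_ _ (tP n))]] := below_region _ _ (sP n.+1).
  by move: E; rewrite tP => -[->].
have [|eps epsP] := region_limit _ (pivot_lim t tdec).
  by move=> n; have [] := tdec n.
exists eps => n; split.
  case: n => [|n]; last by rewrite tP; have [] := epsP n.
  have [[N epsN] _] := epsP 0%N; case E : (s 0%N) => [C|//].
  have [D [E1 /(_ C E)[DC _]]] := below_region _ _ (sP 0%N).
  by exists N => n /epsN h; apply: DC; move: E1; rewrite tP => -[<-].
move=> V oV Veps; have [_ /(_ V oV Veps)[m mV]] := epsP 0%N.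
by exists m.+1; rewrite tP.
Qed.

End Regions.

(** * The equivalences and the D-property *)

Theorem corollary7p7 (U : Type) (G : graph U) :
  [/\ sigma_compact (edge_end G) <-> menger (edge_end G),
      menger (edge_end G) <->
        lindelof (edge_end G) /\ ~ has_closed_copy baire_space (edge_end G) &
      D_space (edge_end G)].
Proof.
have [t] := edge_end_tree G; have t1 := @edge_end_accessible U G.
have menger_c : menger (edge_end G) ->
    lindelof (edge_end G) /\ ~ has_closed_copy baire_space (edge_end G).
  by move=> m; split; [exact: menger_lindelof|exact: menger_no_closed_baire].
have c_sigma : lindelof (edge_end G) /\ ~ has_closed_copy baire_space (edge_end G) ->
    sigma_compact (edge_end G).
  by move=> [l nB]; exact: (tree_sigma_compact t).
split; last exact: (tree_D_space t).
- by split=> [|/menger_c /c_sigma]; first exact: sigma_compact_menger.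
- by split=> // /c_sigma; exact: sigma_compact_menger.
Qed.
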